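(* Let $n\geq 1$, and let $A=(a_{r-s})_{r,s=0}^n$ and $B=(b_{r-s})_{r,s=0}^n$ be real symmetric positive-definite Toeplitz matrices. Let $Q_n^A$ and $Q_n^B$ be their monic orthogonal polynomials of degree $n$ (see context), and put $$P_X(z;\epsilon)=zQ_n^X(z)-\epsilon\,(Q_n^X)^*(z),\quad X\in\{A,B\},\quad \epsilon\in\{-1,1\}.$$ For the parameter $\epsilon$ specified in each case below, write the arguments of the zeros of $P_X(\cdot;\epsilon)$ in the open upper half-plane in increasing order as $$0<\varphi_1^X<\cdots<\varphi_r^X<\pi,\quad r=\lfloor (n+1)/2\rfloor.$$ (i) Put $\epsilon=(-1)^n$. If every zero of $P_B(\cdot;\epsilon)$ has positive real part and $$(-1)^k(b_k-a_k)\geq 0,\quad 0\leq k\leq n,$$ then every zero of $P_A(\cdot;\epsilon)$ also has positive real part and $$\varphi_j^A\leq\varphi_j^B,\quad 1\leq j\leq r.$$ (ii) Put $\epsilon=-1$. If every zero of $P_B(\cdot;-1)$ has negative real part and $$b_k-a_k\geq 0,\quad 0\leq k\leq n,$$ then every zero of $P_A(\cdot;-1)$ also has negative real part and $$\varphi_j^A\geq\varphi_j^B,\quad 1\leq j\leq r.$$ In either case, all the angular inequalities are strict if $A\ne B$.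
   Context: For a real symmetric positive-definite Toeplitz matrix $C=(c_{r-s})_{r,s=0}^n$ with $c_{-j}=c_j$, let $C_n=(c_{r-s})_{r,s=0}^{n-1}$. The associated monic orthogonal polynomial of degree $n$ is $$Q_n(z)=\frac{1}{\det C_n}\det\begin{pmatrix} c_0&c_{-1}&\cdots&c_{-n}\\ c_1&c_0&\cdots&c_{1-n}\\ \vdots&\vdots&&\vdots\\ c_{n-1}&c_{n-2}&\cdots&c_{-1}\\ 1&z&\cdots&z^n\end{pmatrix};$$ equivalently, it is the monic polynomial of degree $n$ orthogonal to $1,z,\ldots,z^{n-1}$ for $\langle f,g\rangle=\mathcal L[\overline f g]$, where $\mathcal L[z^j]=c_{-j}$ for $|j|\leq n$ and conjugation is taken on the unit circle ($\overline z=z^{-1}$). The reversed polynomial is $Q_n^*(z)=z^n\overline{Q_n(1/\overline z)}$, with value at $z=0$ by polynomial continuation. For $\epsilon\in\{-1,1\}$ the polynomial $zQ_n-\epsilon Q_n^*$ is monic of degree $n+1$ with real coefficients and has $n+1$ simple zeros, all on the unit circle. *)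

(* Defs.v *)
From HB Require Import structures.
From mathcomp Require Import all_boot all_order all_algebra.
From mathcomp Require Import all_classical all_reals all_analysis.
From mathcomp Require Import complex.
Set Implicit Arguments.
Unset Strict Implicit.
Unset Printing Implicit Defensive.
Import Order.TTheory GRing.Theory Num.Theory.
Local Open Scope ring_scope.
Local Open Scope complex_scope.

Definition toeplitz (R : realType) (m : nat) (c : int -> R) : 'M[R]_m :=
  \matrix_(r, s) c (r%:Z - s%:Z).

Definition sym_posdef (R : realType) (m : nat) (A : 'M[R]_m) : Prop :=
  A^T = A /\ forall x : 'cV[R]_m, x != 0 -> 0 < (x^T *m A *m x) 0 0.

Definition monic_op (R : realType) (n : nat) (c : int -> R) : {poly R} :=
  (\det (toeplitz n c))^-1 *:
    \det (\matrix_(i < n.+1, j < n.+1)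
            (if (i < n)%N then (c (i%:Z - j%:Z))%:P else 'X^j)).

(* [rev_conj n q] is z^n * conj (q (1 / conj z)) continued to z = 0; it is
   written out coefficientwise, see [horner_rev_conj]. *)
Definition rev_conj (R : realType) (n : nat) (q : {poly R[i]}) : {poly R[i]} :=
  \poly_(k < n.+1) conjc q`_(n - k).

Lemma horner_rev_conj (R : realType) (n : nat) (q : {poly R[i]}) (z : R[i]) :
  (size q <= n.+1)%N -> z != 0 ->
  (rev_conj n q).[z] = z ^+ n * conjc q.[(conjc z)^-1].
Proof.
move=> sq z0; rewrite horner_poly (horner_coef_wide _ sq) rmorph_sum mulr_sumr.
rewrite (reindex_inj rev_ord_inj) /=; apply: eq_bigr => k _.
have kn : (k <= n)%N by rewrite -ltnS.
rewrite subSS subKn // rmorphM rmorphXn /= fmorphV /= conjcK mulrCA exprVn.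
by congr (_ * _); rewrite -exprB ?unitfE.
Qed.

Definition paraorth (R : realType) (n : nat) (c : int -> R) (eps : R) :
    {poly R[i]} :=
  let Q := map_poly (real_complex R) (monic_op n c) in
  'X * Q - eps%:C *: rev_conj n Q.

(* The argument of a complex number in the open upper half-plane, see
   [upper_argP]; nothing is claimed for other numbers. *)
Definition upper_arg (R : realType) (z : R[i]) : R :=
  acos (complex.Re z / complex.Re `|z|).

Lemma upper_argP (R : realType) (z : R[i]) : 0 < complex.Im z ->
  0 < upper_arg z < pi /\
  z = `|z| * (cos (upper_arg z) +i* sin (upper_arg z)).
Proof.
case: z => a b /= b0; rewrite /upper_arg normc_def /=.
set s := Num.sqrt _.
have s2 : s ^+ 2 = a ^+ 2 + b ^+ 2 by rewrite sqr_sqrtr // addr_ge0 ?sqr_ge0.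
have s0 : 0 < s by rewrite sqrtr_gt0 ltr_wpDl ?sqr_ge0 ?exprn_gt0.
have /andP[h1 h2] : -1 < a / s < 1.
  rewrite ltr_pdivlMr // ltr_pdivrMr // mulN1r mul1r -ltr_norml.
  by rewrite -ltr_sqr ?nnegrE ?(ltW s0) // real_normK ?num_real // s2 ltrDl exprn_gt0.
split; first by rewrite acos_gt0 ?acos_ltpi ?h1 ?h2 ?ltW.
rewrite acosK ?in_itv /= ?(ltW h1) ?(ltW h2) // sin_acos ?(ltW h1) ?(ltW h2) //.
have -> : 1 - (a / s) ^+ 2 = (b / s) ^+ 2.
  rewrite !expr_div_n; apply/eqP; rewrite subr_eq -mulrDl (addrC (b ^+ 2)) -s2.
  by rewrite divff // expf_neq0 ?gt_eqF.
rewrite sqrtr_sqr ger0_norm ?divr_ge0 ?ltW //.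
by rewrite /GRing.mul /= !mul0r subr0 addr0 !(mulrC s) !divfK ?gt_eqF.
Qed.

(* All zeros of [p], listed with multiplicity. *)
Definition zeros (R : realType) (p : {poly R[i]}) : seq R[i] :=
  sval (closed_field_poly_normal p).

Lemma mem_zeros (R : realType) (p : {poly R[i]}) (z : R[i]) :
  p != 0 -> (z \in zeros p) = root p z.
Proof.
move=> p0; rewrite /zeros; case: closed_field_poly_normal => r /= def_p.
by rewrite [in RHS]def_p rootZ ?lead_coef_eq0 // root_prod_XsubC.
Qed.

(* The arguments of the zeros of [p] in the open upper half-plane, in
   increasing order and indexed from 0. For [paraorth n c eps] with c symmetric
   positive definite the n + 1 zeros are simple, so there are no repetitions;
   in the two cases compared (eps = (-1)^n and eps = -1) at most one zero is
   real, so there are exactly [n.+1./2] angles. *)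
Definition zero_angles (R : realType) (p : {poly R[i]}) : seq R :=
  sort <=%R [seq upper_arg z | z <- zeros p & 0 < complex.Im z].

(* Main.v *)
Require Import Defs.
From HB Require Import structures.
From mathcomp Require Import all_boot all_order all_algebra.
From mathcomp Require Import all_classical all_reals all_analysis.
From mathcomp Require Import complex.
From mathcomp Require Import ring lra zify.
Import Order.TTheory GRing.Theory Num.Theory.
Local Open Scope ring_scope.
Local Open Scope complex_scope.
Set Implicit Arguments.
Unset Strict Implicit.
Unset Printing Implicit Defensive.

(** Let L be the functional sending z^j to c_(-j), so that [moment c s f] is
    L[z^(-s) f].  The polynomial P = zQ - eps Q* is real, monic of degree
    n + 1, self-reciprocal up to the sign - eps, and L[z^(-k) P] = 0 for
    k = 1, ..., n ([paraorth_real_form]).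
    Positive definiteness makes its zeros simple and unimodular
    ([paraorthogonal_no_reflected_pair]), so that for eps = -1
    P = (z + 1)^e prod_k (z^2 - 2 x_k z + 1), with e the parity of n + 1 and
    the x_k the cosines of the angles ([factor_paraorthogonal]).  The claim of
    (ii) is then that the cosines x_k for A lie strictly below the cosines y_k
    for B, in the same order, unless A = B.

    Take away one factor: q_j = P_B / (z^2 - 2 y_j z + 1).  The polynomial
    (P_A - P_B) / z has degree less than n, and interpolating it at the zeros
    of P_B gives sum_j r_j q_j, where
      r_j = 2 prod_k (y_j - x_k) / prod_(k != j) (y_j - y_k).
    Pairing with the q_j and using both orthogonality relations produces a
    linear system H r = v with
      H_jk = L_A[z^(1 - n) q_j q_k]   and   v_j = L_(B - A)[z^(- n) q_j P_B].
    All the y_k being negative, the q_j and P_B have positive coefficients;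
    as the entries of B - A are nonnegative and not all 0, v is positive, and
    H_jk = 0 - L_(B - A)[z^(1 - n) q_j q_k] is nonpositive for j != k, the
    zero being orthogonality for B.  Moreover H is positive definite.  Such a
    matrix (a symmetric M-matrix) has a nonnegative inverse, so r is positive
    ([m_matrix_pos], [comparison_sign]): prod_k (y_j - x_k) has the sign of
    prod_(k != j) (y_j - y_k), which alternates with j.  Counting the x_k above
    each y_j then leaves x_j < y_j as the only possibility
    ([sign_alternation_lt]).  In particular every x_j is negative.

    Case (i) is case (ii) for the sequences (-1)^k a_k and (-1)^k b_k, whose
    polynomials are those of a and b up to sign after z -> - z. *)

(** * The moment functional *)

(** The value L[z^(-s) f] of the functional with L[z^j] = c_(-j). *)
Definition moment (F : nzRingType) (c : int -> F) (s : int) (f : {poly F}) : F :=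
  \sum_(j < size f) f`_j * c (s - j%:Z).

Section Moment.
Variables (F : comNzRingType) (c : int -> F).
Implicit Types (f g : {poly F}) (s : int).

Lemma moment_widen m s f : (size f <= m)%N ->
  moment c s f = \sum_(j < m) f`_j * c (s - j%:Z).
Proof.
move=> fm; rewrite /moment (big_ord_widen m (fun j => f`_j * c (s - j%:Z))) //.
rewrite big_mkcond /=; apply: eq_bigr => j _; case: ltnP => // fj.
by rewrite nth_default ?mul0r.
Qed.

Lemma momentD s f g : moment c s (f + g) = moment c s f + moment c s g.
Proof.
rewrite !(@moment_widen (maxn (size f) (size g))) ?leq_maxl ?leq_maxr ?size_polyD // -big_split /=.
by apply: eq_bigr => j _; rewrite coefD mulrDl.
Qed.

Lemma momentZ s k f : moment c s (k *: f) = k * moment c s f.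
Proof.
rewrite !(@moment_widen (size f)) ?size_scale_leq // mulr_sumr.
by apply: eq_bigr => j _; rewrite coefZ mulrA.
Qed.

Lemma moment0 s : moment c s 0 = 0.
Proof. by rewrite /moment size_poly0 big_ord0. Qed.

Lemma moment_sum s (I : Type) (r : seq I) (h : I -> {poly F}) :
  moment c s (\sum_(i <- r) h i) = \sum_(i <- r) moment c s (h i).
Proof.
elim: r => [|i r IH]; first by rewrite !big_nil moment0.
by rewrite !big_cons momentD IH.
Qed.

Lemma momentMX s f : moment c (s + 1) ('X * f) = moment c s f.
Proof.
have szX : (size ('X * f)%R <= (size f).+1)%N.
  by rewrite (leq_trans (size_polyMleq _ _)) // size_polyX.
rewrite (moment_widen _ szX) big_ord_recl coefXM eqxx mul0r add0r.
apply: eq_bigr => j _; rewrite coefXM /=; congr (_ * c _).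
by rewrite /bump add1n; move: (nat_of_ord j) => i; lia.
Qed.

Lemma momentMXn s i f : moment c s ('X^i * f) = moment c (s - i%:Z) f.
Proof.
elim: i s => [|i IH] s; first by rewrite expr0 mul1r subr0.
by rewrite exprS -mulrA -[s in LHS](subrK 1) momentMX IH; congr moment; lia.
Qed.

Lemma momentM m s f g : (size f <= m)%N ->
  moment c s (f * g) = \sum_(i < m) f`_i * moment c (s - i%:Z) g.
Proof.
move=> fm; have {1}-> : f = \sum_(i < m) f`_i *: 'X^i.
  rewrite -[LHS]coefK poly_def (big_ord_widen m (fun i => f`_i *: 'X^i)) //.
  rewrite big_mkcond /=; apply: eq_bigr => j _; case: ltnP => // fj.
  by rewrite nth_default ?scale0r.
rewrite mulr_suml moment_sum; apply: eq_bigr => i _.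
by rewrite -scalerAl momentZ momentMXn.
Qed.

Lemma moment_orth n (f P : {poly F}) :
  (forall k : nat, (0 < k <= n)%N -> moment c k%:Z P = 0) ->
  (size f <= n)%N -> moment c n%:Z (f * P) = 0.
Proof.
move=> orthP fn; rewrite (momentM _ _ fn) big1 // => i _.
have ? := ltn_ord i; have -> : n%:Z - i%:Z = (n - i)%:Z by lia.
by rewrite orthP ?mulr0 // subn_gt0 ltn_ord leq_subr.
Qed.

End Moment.

(** When g is the reversal of h, z^(-n) g is the conjugate of h on the circle
    (for real coefficients), so the left-hand side is the inner product of h
    and f.  Letting h be a separate polynomial covers both the Hermitian
    product and the products of self-reciprocal polynomials. *)
Lemma moment_form (F : comNzRingType) (c : int -> F) n (f g h : {poly F}) :
  (size f <= n.+1)%N -> (size g <= n.+1)%N ->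
  (forall j, (j <= n)%N -> g`_(n - j) = h`_j) ->
  moment c n (f * g) =
    \sum_(i < n.+1) \sum_(j < n.+1) f`_i * h`_j * c (j%:Z - i%:Z).
Proof.
move=> fn gn gh; rewrite (momentM _ _ _ fn); apply: eq_bigr => i _.
rewrite (moment_widen _ _ gn) mulr_sumr (reindex_inj rev_ord_inj) /=.
apply: eq_bigr => j _; have jn : (j <= n)%N by rewrite -ltnS.
rewrite subSS gh // mulrA; congr (_ * c _).
by move: (nat_of_ord i) (nat_of_ord j) jn => i' j' jn; lia.
Qed.

(** * Positive definite sequences *)

Definition posdef (R : realType) n (c : int -> R) : Prop :=
  forall f : {poly R}, f != 0 -> (size f <= n.+1)%N ->
  0 < \sum_(i < n.+1) \sum_(j < n.+1) f`_i * f`_j * c (j%:Z - i%:Z).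

Definition even_upto (R : realType) n (c : int -> R) : Prop :=
  forall i j : nat, (i <= n)%N -> (j <= n)%N -> c (i%:Z - j%:Z) = c (j%:Z - i%:Z).

Section Toeplitz.
Variables (R : realType) (n : nat) (c : int -> R).

Lemma sym_posdef_even : sym_posdef (toeplitz n.+1 c) -> even_upto n c.
Proof.
case=> sym _ i j iln jln.
have ilt : (i < n.+1)%N by []. have jlt : (j < n.+1)%N by [].
by move/matrixP/(_ (Ordinal jlt) (Ordinal ilt)): sym; rewrite !mxE.
Qed.

Lemma sym_posdef_posdef : sym_posdef (toeplitz n.+1 c) -> posdef n c.
Proof.
case=> _ pos f f0 fn; pose x : 'cV[R]_n.+1 := \col_i f`_i.
have x0 : x != 0.
  apply: contra_neq f0 => x0; apply/polyP => i; rewrite coef0.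
  have [iln|/(leq_trans fn)] := ltnP i n.+1; last exact: nth_default.
  by move/colP/(_ (Ordinal iln)): x0; rewrite !mxE.
have := pos x x0; rewrite mxE; congr (_ < _).
apply: eq_bigr => j _; rewrite !mxE mulr_suml.
by apply: eq_bigr => i _; rewrite !mxE; ring.
Qed.

Definition complex_seq : int -> R[i] := fun k => (c k)%:C.

(** The real part of this Hermitian form is the sum of the real forms at the
    real and at the imaginary part of T. *)
Lemma posdef_hermitian (T : {poly R[i]}) : posdef n c ->
  T != 0 -> (size T <= n.+1)%N ->
  moment complex_seq n (T * rev_conj n T) != 0.
Proof.
move=> pos T0 Tn.
pose g : {poly R[i]} := \poly_(k < n.+1) conjc T`_k.
rewrite (@moment_form _ _ _ _ _ g) // ?size_poly //; last first.
  by move=> j jn; rewrite !coef_poly ltnS leq_subr ltnS jn subKn.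
pose fr : {poly R} := \poly_(k < n.+1) complex.Re T`_k.
pose fi : {poly R} := \poly_(k < n.+1) complex.Im T`_k.
pose Q (f : {poly R}) :=
  \sum_(i < n.+1) \sum_(j < n.+1) f`_i * f`_j * c (j%:Z - i%:Z).
have Q0 (f : {poly R}) : (size f <= n.+1)%N -> 0 <= Q f ?= iff (f == 0).
  move=> fn; apply/leifP; case: eqP => [->|/eqP f0]; last exact: pos.
  by rewrite /Q big1 // => i _; rewrite big1 // => j _; rewrite coef0 !mul0r.
suff Re_eq : complex.Re (\sum_(i < n.+1) \sum_(j < n.+1)
    T`_i * g`_j * complex_seq (j%:Z - i%:Z)) = Q fr + Q fi.
  apply: contra_neq T0 => /(congr1 (@complex.Re R)); rewrite Re_eq /= => /eqP.
  have [hr er] := Q0 fr (size_poly _ _); have [hi ei] := Q0 fi (size_poly _ _).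
  rewrite paddr_eq0 // ![_ == 0]eq_sym er ei => /andP[/eqP fr0 /eqP fi0].
  apply/polyP => i; rewrite coef0.
  have [iln|/(leq_trans Tn)] := ltnP i n.+1; last exact: nth_default.
  move/polyP/(_ i): fr0; move/polyP/(_ i): fi0.
  by rewrite !coef_poly iln !coef0; case: (T`_i) => u v /= -> ->.
rewrite raddf_sum /Q -big_split /=; apply: eq_bigr => i _.
rewrite raddf_sum -big_split /=; apply: eq_bigr => j _.
rewrite !coef_poly !ltn_ord /complex_seq.
by case: (T`_i) (T`_j) => u v [u' v'] /=; ring.
Qed.

End Toeplitz.

(** * The orthogonal polynomial and the para-orthogonal polynomial *)

Section MonicOp.
Variables (R : realType) (n : nat) (c : int -> R).
Hypothesis posc : posdef n c.
Let Q := monic_op n c.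

(* The matrix defining Q, with an arbitrary last row v: its determinant is
   linear in v, and equals a multiple of the moment of Q when v consists of
   entries of c. *)
Let N (v : nat -> R) : 'M[R]_n.+1 :=
  \matrix_(i, j) if (i < n)%N then c (i%:Z - j%:Z) else v j.

(** A kernel vector of the smaller Toeplitz matrix, read as a polynomial of
    degree less than n, would be isotropic for the larger form. *)
Lemma toeplitz_det_neq0 : \det (toeplitz n c) != 0.
Proof.
apply/det0P => -[x x0 xC].
pose f : {poly R} := rVpoly x.
have f0 : f != 0 by rewrite -(rVpolyK x) in x0; apply: contra_neq x0 => f0; rewrite -/f f0 linear0.
have fn : (size f <= n)%N by rewrite /f /rVpoly size_poly.
have := posc f0 (leq_trans fn (leqnSn n)); rewrite ltNge => /negP[].
rewrite big_ord_recr /= [X in _ + X]big1 => [|i _]; last first.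
  by rewrite (nth_default _ fn) !mul0r.
rewrite addr0 big1 // => j _.
rewrite big_ord_recr /= (nth_default _ fn) mulr0 mul0r addr0.
move/rowP/(_ j): xC; rewrite !mxE => xC; rewrite -[RHS](mulr0 f`_j) -[X in _ = _ * X]xC mulr_sumr.
by apply: eq_bigr => i _; rewrite !mxE /f !coef_rVpoly_ord mulrA.
Qed.

Let detN v : \det (N v) = \sum_(j < n.+1) v j * cofactor (N (fun=> 0)) ord_max j.
Proof.
rewrite (expand_det_row _ ord_max); apply: eq_bigr => j _.
rewrite mxE ltnn; congr (_ * (_ * \det _)).
by apply/matrixP => i k; rewrite !mxE lift_max ltn_ord.
Qed.

Lemma monic_opE :
  Q = \poly_(j < n.+1) ((\det (toeplitz n c))^-1 * cofactor (N (fun=> 0)) ord_max (inord j)).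
Proof.
rewrite /Q /monic_op (expand_det_row _ ord_max) poly_def scaler_sumr.
apply: eq_bigr => j _; rewrite inord_val -scalerA mxE ltnn; congr (_ *: _).
rewrite -mul_polyC mulrC; congr (_ * _).
rewrite /cofactor rmorphM rmorph_sign /= -det_map_mx; congr (_ * \det _).
by apply/matrixP => i k; rewrite !mxE lift_max ltn_ord.
Qed.

Lemma size_monic_op : (size Q <= n.+1)%N.
Proof. by rewrite monic_opE size_poly. Qed.

Lemma monic_op_lead : Q`_n = 1.
Proof.
rewrite monic_opE coef_poly ltnSn.
rewrite [inord n](_ : _ = ord_max); last by apply: val_inj; rewrite /= inordK.
rewrite /cofactor addnn -signr_odd odd_double mul1r.
have -> : \det (row' ord_max (col' ord_max (N (fun=> 0)))) = \det (toeplitz n c).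
  by congr (\det _); apply/matrixP => i j; rewrite !mxE !lift_max ltn_ord.
by rewrite mulVf ?toeplitz_det_neq0.
Qed.

(** The moment is a determinant whose last row repeats row k. *)
Lemma monic_op_orth k : (k < n)%N -> moment c k Q = 0.
Proof.
move=> kn; rewrite (moment_widen _ _ size_monic_op).
have := detN (fun j => c (k%:Z - j%:Z)).
have kn1 := ltnW kn; rewrite -ltnS in kn1.
rewrite (determinant_alternate (i1 := Ordinal kn1) (i2 := ord_max)); last first.
- by move=> j; rewrite !mxE /= kn ltnn.
- by rewrite -val_eqE /= neq_ltn kn.
move/(congr1 (GRing.mul (\det (toeplitz n c))^-1)); rewrite mulr0 mulr_sumr => e0.
rewrite [RHS]e0; apply: eq_bigr => j _; rewrite monic_opE coef_poly ltn_ord inord_val; ring.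
Qed.

End MonicOp.

(** The four properties of z Q_n - eps Q_n^* used below, with s = - eps.  Unlike
    the determinantal formula they are visibly stable under z -> - z. *)
Definition paraorthogonal (R : realType) n (c : int -> R) (s : R) (P : {poly R}) : Prop :=
  [/\ P \is monic, size P = n.+2,
      forall k : nat, (0 < k <= n)%N -> moment c k P = 0
    & forall k, (k <= n.+1)%N -> P`_(n.+1 - k) = s * P`_k].

Lemma coef_rev_conj (R : realType) n (q : {poly R[i]}) k :
  (rev_conj n q)`_k = if (k < n.+1)%N then conjc q`_(n - k) else 0.
Proof. exact: coef_poly. Qed.

Lemma paraorth_real_form (R : realType) n (c : int -> R) (eps : R) :
  (0 < n)%N -> posdef n c -> even_upto n c -> eps ^+ 2 = 1 ->
  exists2 P, paraorthogonal n c (- eps) P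
    & paraorth n c eps = map_poly (real_complex R) P.
Proof.
move=> n0 pos ev eps2; rewrite /paraorth.
have orth := @monic_op_orth R n c; have lead := monic_op_lead pos.
move: orth lead (size_monic_op n c).
move: (monic_op n c) => Q Qorth Qn szQ.
have Q0 k : (n < k)%N -> Q`_k = 0 by move=> nk; rewrite nth_default // (leq_trans szQ).
pose Qr : {poly R} := \poly_(k < n.+1) Q`_(n - k).
have szQr : (size Qr <= n.+1)%N by exact: size_poly.
pose P := 'X * Q - eps *: Qr.
have Pk k : (k <= n.+1)%N ->
    P`_k = (if k == 0%N then 0 else Q`_k.-1)
           - eps * (if k == n.+1 then 0 else Q`_(n - k)).
  move=> kn; rewrite coefB coefXM coefZ /Qr coef_poly; congr (_ - _ * _).
  by move: kn; rewrite leq_eqVlt; case: eqP => [->|_ /= ->] //; rewrite ltnn.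
have szP : (size P <= n.+2)%N.
  rewrite (leq_trans (size_polyD _ _)) // geq_max size_polyN.
  rewrite (leq_trans (size_scale_leq _ _)) ?(leq_trans szQr) // andbT.
  by rewrite (leq_trans (size_polyMleq _ _)) // size_polyX.
have Plead : P`_n.+1 = 1 by rewrite Pk // eqxx mulr0 subr0.
have szP2 : size P = n.+2.
  apply/eqP; rewrite eqn_leq szP ltnNge; apply/negP => h; move: Plead.
  by rewrite nth_default // => /esym/eqP; rewrite oner_eq0.
exists P; last first.
  have coefQr k : Qr`_k = if (k < n.+1)%N then Q`_(n - k) else 0 by exact: coef_poly.
  apply/polyP => k; rewrite coef_map /= /P !(coefB, coefXM, coefZ) coef_rev_conj coefQr.
  rewrite !coef_map /= rmorphB rmorphM /=; case: (k == 0%N); case: (k < n.+1)%N => //=;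
    by rewrite ?oppr0 ?rmorph0.
split => //.
- by apply/monicP; rewrite /lead_coef szP2.
- move=> k /andP[k0 kn]; rewrite momentD -scaleN1r !momentZ.
  have -> : k%:Z = k.-1%:Z + 1 by lia.
  rewrite momentMX Qorth ?prednK // add0r.
  (* Reversing Q turns its k-th moment into its (n - k)-th, since c is even. *)
  suff -> : moment c (k.-1%:Z + 1) Qr = moment c (n - k)%N Q.
    by rewrite Qorth ?mulr0 // ltn_subrL k0 n0.
  rewrite (moment_widen _ _ szQr) (moment_widen _ _ szQ) (reindex_inj rev_ord_inj) /=.
  apply: eq_bigr => j _; have jn : (j <= n)%N by rewrite -ltnS.
  rewrite subSS /Qr coef_poly ltnS leq_subr subKn //; congr (_ * _).
  have -> : k.-1%:Z + 1 - (n - j)%N%:Z = k%:Z - (n - j)%N%:Z by lia.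
  by rewrite ev ?leq_subr //; congr c; lia.
- move=> k kn; rewrite !Pk ?leq_subr //.
  have -> : (n.+1 - k == 0)%N = (k == n.+1) by lia.
  have -> : (n.+1 - k == n.+1)%N = (k == 0%N) by lia.
  have -> : (n.+1 - k).-1 = (n - k)%N by lia.
  have -> : (n - (n.+1 - k))%N = k.-1 by lia.
  by rewrite mulrBr !mulNr opprK [eps * (eps * _)]mulrA -expr2 eps2 mul1r addrC.
Qed.

(** * The zeros are simple and lie on the unit circle *)

Lemma rev_conj_mulXsubC (R : realType) n (al : R[i]) (S : {poly R[i]}) :
  (size S <= n.+1)%N ->
  rev_conj n.+1 (('X - al%:P) * S) = (1 - (conjc al) *: 'X) * rev_conj n S.
Proof.
move=> Sn; apply/polyP => k.
rewrite !(mulrBl, mul1r) -scalerAl coefB coefZ coefXM !coef_rev_conj.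
rewrite coefB coefXM coefCM rmorphB rmorphM /=.
have S0 : S`_n.+1 = 0 by rewrite nth_default.
case: k => [|k] /=; first by rewrite !subn0 /= S0 conjc0 !mulr0 subr0.
rewrite [(k.+1 < n.+2)%N]ltnS [(k.+1 < n.+1)%N]ltnS ltnS !subSS subn_eq0 subnS.
case: (ltngtP k n) => kn /=; first by [].
  by rewrite mulr0 subrr.
by rewrite oppr0.
Qed.

Lemma nuniq_mem_rem (T : eqType) (s : seq T) :
  ~~ uniq s -> exists2 x, x \in s & x \in rem x s.
Proof.
elim: s => //= x s IH; rewrite negb_and negbK; case/orP => [xs|/IH[y ys yr]].
  by exists x; rewrite ?mem_head ?eqxx.
exists y; first by rewrite in_cons ys orbT.
by case: eqP => // _; rewrite in_cons yr orbT.
Qed.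

Section ParaorthZeros.
Variables (R : realType) (n : nat) (c : int -> R) (s : R) (P : {poly R}).
Hypotheses (n0 : (0 < n)%N) (pos : posdef n c) (s2 : s ^+ 2 = 1).
Hypothesis paraP : paraorthogonal n c s P.
Let PC : {poly R[i]} := map_poly (real_complex R) P.

Let P_monic : P \is monic. Proof. by case: paraP. Qed.
Let sizeP : size P = n.+2. Proof. by case: paraP. Qed.
Let orthP k : (0 < k <= n)%N -> moment c k%:Z P = 0.
Proof. by case: paraP => _ _ h _; exact: h. Qed.
Let recP k : (k <= n.+1)%N -> P`_(n.+1 - k) = s * P`_k.
Proof. by case: paraP => _ _ _ h; exact: h. Qed.

Let s0 : s != 0.
Proof.
by apply/eqP => s0; move: s2; rewrite s0 expr0n => /esym/eqP; rewrite oner_eq0.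
Qed.

Lemma paraorthogonal_coef0 : P`_0 = s.
Proof.
have := recP (leqnn n.+1); rewrite subnn => ->.
by move/monicP: P_monic; rewrite /lead_coef sizeP => ->; rewrite mulr1.
Qed.

Let sizePC : size PC = n.+2. Proof. by rewrite size_map_poly. Qed.
Let PC0 : PC != 0. Proof. by rewrite -size_poly_eq0 sizePC. Qed.
Let coefPC k : PC`_k = (P`_k)%:C. Proof. exact: coef_map. Qed.

Lemma moment_complex (k : int) : moment (complex_seq c) k PC = (moment c k P)%:C.
Proof.
rewrite /moment size_map_poly rmorph_sum; apply: eq_bigr => j _.
by rewrite coefPC rmorphM.
Qed.

(** Put T = (z - al) S.  The reversal of T is (1 - al^* z) times that of S, so
    T times its reversal is P times the reversal of S.  The latter has degree
    less than n, hence orthogonality of P makes the squared norm of T vanish. *)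
Lemma paraorthogonal_no_reflected_pair (al : R[i]) (S : {poly R[i]}) :
  PC <> ('X - al%:P) * (1 - conjc al *: 'X) * S.
Proof.
move=> PE.
have al0 : al != 0.
  apply: contra_neq (s0) => al0; apply/complexI.
  by rewrite -paraorthogonal_coef0 -coefPC PE al0 subr0 -mulrA coefXM.
have S0 : S != 0 by apply: contraNneq PC0 => S0; rewrite PE S0 mulr0.
have T0 : ('X - al%:P) * S != 0 by rewrite mulf_neq0 ?polyXsubC_eq0.
have szl : size (1 - conjc al *: 'X : {poly R[i]}) = 2.
  rewrite addrC size_polyDl ?size_polyN size_scale ?conjc_eq0 // ?size_polyX //.
  by rewrite size_poly1.
have szT : size (('X - al%:P) * S) = n.+1.
  have := sizePC; rewrite PE mulrAC size_mul // -?size_poly_eq0 szl //.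
  by rewrite addn2 /= => -[].
have szS : size S = n.
  by move: szT; rewrite size_mul ?polyXsubC_eq0 // size_XsubC add2n => -[].
have := posdef_hermitian pos T0; rewrite szT leqnn => /(_ isT)/negP; apply.
case: n n0 szS orthP => // n' _ szS orth.
rewrite rev_conj_mulXsubC ?szS //.
rewrite mulrA -(mulrA _ S) (mulrC S) mulrA -PE mulrC moment_orth ?size_poly //.
by move=> k kn; rewrite moment_complex orth.
Qed.

Lemma zeros_prod : PC = \prod_(z <- zeros PC) ('X - z%:P).
Proof.
rewrite /zeros; case: closed_field_poly_normal => r /= {1}->.
by rewrite (monicP _) ?scale1r ?map_monic.
Qed.

Lemma root_reflect (z : R[i]) : root PC z -> root PC (conjc z)^-1.
Proof.
move=> /rootP PCz.
have z0 : z != 0.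
  apply: contra_eq_neq PCz => ->; rewrite horner_coef0 coefPC.
  by rewrite paraorthogonal_coef0; apply: contra_neq (s0) => /complexI.
have revE : rev_conj n.+1 PC = s%:C *: PC.
  apply/polyP => k; rewrite coef_rev_conj coefZ !coefPC ltnS.
  case: leqP => kn; first by rewrite conjc_real recP // rmorphM.
  by rewrite nth_default ?mulr0 // sizeP.
have := @horner_rev_conj _ n.+1 PC (conjc z)^-1.
rewrite sizePC invr_eq0 conjc_eq0 => /(_ (leqnn _) z0).
rewrite revE hornerZ conjc_inv conjcK invrK PCz conjc0 mulr0 => /eqP.
rewrite mulf_eq0 => /orP[|//]; rewrite (inj_eq (@complexI R)).
by move: s0 => /negPf->.
Qed.

(* Covers at once a zero off the circle, whose reflection is another zero, and
   a double zero on the circle, which is its own reflection. *)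
Let reflect_notin z : z \in zeros PC -> (conjc z)^-1 \notin rem z (zeros PC).
Proof.
move=> zs; apply/negP => ws.
have z0 : z != 0.
  rewrite mem_zeros // in zs; move/rootP: zs; apply: contra_eq_neq => ->.
  rewrite horner_coef0 coefPC paraorthogonal_coef0; apply: contra_neq (s0).
  exact: complexI.
have := zeros_prod.
rewrite (perm_big _ (perm_to_rem zs)) big_cons (perm_big _ (perm_to_rem ws)) big_cons.
set S := \prod_(_ <- _) _ => PE.
apply: (@paraorthogonal_no_reflected_pair z ((- conjc z)^-1 *: S)).
rewrite PE -!mulrA; congr (_ * _).
rewrite -scalerAr scalerAl; congr (_ * _).
rewrite scalerBr scalerA -mul_polyC mulr1 invrN mulNr mulVf ?conjc_eq0 //.
by rewrite scaleNr scale1r polyCN opprK addrC.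
Qed.

Lemma paraorthogonal_zero_unit (z : R[i]) : root PC z -> z * conjc z = 1.
Proof.
move=> rz; have zs : z \in zeros PC by rewrite mem_zeros.
have ws : (conjc z)^-1 \in zeros PC by rewrite mem_zeros // root_reflect.
have := reflect_notin zs.
have := perm_mem (perm_to_rem zs) (conjc z)^-1; rewrite ws in_cons.
case: (boolP (_ \in rem _ _)) => //= _; rewrite orbF => /esym/eqP e _.
have z0 : conjc z != 0.
  apply: contraTneq rz => /eqP; rewrite conjc_eq0 => /eqP ->.
  by rewrite /root horner_coef0 coefPC paraorthogonal_coef0 (inj_eq (@complexI R)).
by rewrite -{1}e mulVf.
Qed.

Lemma paraorthogonal_zeros_uniq : uniq (zeros PC).
Proof.
apply/negP => /negP /nuniq_mem_rem [z zs].
have rz : root PC z by rewrite -mem_zeros.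
have := reflect_notin zs; have zz := paraorthogonal_zero_unit rz.
suff -> : (conjc z)^-1 = z by move/negP.
have z0 : conjc z != 0 by apply: contra_eq_neq zz => ->; rewrite mulr0 eq_sym oner_neq0.
by apply: (mulIf z0); rewrite zz mulVf.
Qed.

End ParaorthZeros.

(** * Factorization by the angles of the zeros *)

(** The real polynomial with zeros exp(i t) and exp(- i t), where x = cos t. *)
Definition circle_pair (R : realType) (x : R) : {poly R} := 'X^2 - (2 * x) *: 'X + 1.

Lemma circle_pairE (R : realType) (z : R[i]) : z * conjc z = 1 ->
  ('X - z%:P) * ('X - (conjc z)%:P) = map_poly (real_complex R) (circle_pair (complex.Re z)).
Proof.
move=> zz; rewrite /circle_pair rmorphD rmorphB /= map_polyXn rmorph1.
rewrite -mul_polyC rmorphM /= map_polyC map_polyX /=.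
have -> : (2 * complex.Re z)%:C = z + conjc z.
  by rewrite addcJ rmorphM /= rmorph_nat.
rewrite mulrBl !mulrBr -polyCM zz polyCD expr2 mulrDl.
by rewrite [z%:P * 'X]mulrC [_^*%:P * 'X]mulrC; ring.
Qed.

Lemma monic_circle_pair (R : realType) (x : R) :
  circle_pair x \is monic /\ size (circle_pair x) = 3.
Proof.
have sz : (size (- ((2 * x) *: 'X) + 1 : {poly R})%R < 3)%N.
  rewrite (leq_ltn_trans (size_polyD _ _)) // size_polyN size_poly1 gtn_max andbT.
  by rewrite (leq_ltn_trans (size_scale_leq _ _)) // size_polyX.
rewrite /circle_pair -addrA; split.
  by rewrite monicE lead_coefDl ?lead_coefXn ?size_polyXn.
by rewrite size_polyDl size_polyXn.
Qed.

Lemma monic_circle_pairs (R : realType) (xs : seq R) :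
  \prod_(x <- xs) circle_pair x \is monic /\
  size (\prod_(x <- xs) circle_pair x) = (size xs).*2.+1.
Proof.
elim: xs => [|x xs [mxs sxs]]; first by rewrite big_nil monic1 size_poly1.
have [mx sx] := monic_circle_pair x.
by rewrite big_cons monicMl // size_Mmonic ?monic_neq0 // sx sxs.
Qed.

Lemma size_exp_XaddC (R : idomainType) k (a : R) : size (('X + a%:P) ^+ k) = k.+1.
Proof. by rewrite -[a]opprK polyCN size_exp_XsubC. Qed.

Lemma unit_Re_Im (R : realType) (z : R[i]) : z * conjc z = 1 ->
  complex.Re z ^+ 2 + complex.Im z ^+ 2 = 1.
Proof.
case: z => u v /(congr1 (@complex.Re R)) /= h; rewrite -[RHS]h; ring.
Qed.

Lemma cos_upper_arg (R : realType) (z : R[i]) : z * conjc z = 1 ->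
  cos (upper_arg z) = complex.Re z.
Proof.
move=> zz; rewrite /upper_arg normc_def unit_Re_Im // sqrtr1 divr1 acosK //.
have := unit_Re_Im zz; rewrite in_itv /= => h.
have {}h : complex.Re z ^+ 2 <= 1 by rewrite -h lerDl sqr_ge0.
by rewrite -ler_norml -(expr_le1 (n := 2)) ?real_normK ?num_real.
Qed.

Section Factor.
Variables (R : realType) (n : nat) (c : int -> R) (s : R) (P : {poly R}).
Hypotheses (n0 : (0 < n)%N) (pos : posdef n c) (s2 : s ^+ 2 = 1).
Hypothesis paraP : paraorthogonal n c s P.
Let PC : {poly R[i]} := map_poly (real_complex R) P.
Let zs := zeros PC.
Let U := [seq z <- zs | 0 < complex.Im z].
Let ths := zero_angles PC.

Let PC0 : PC != 0.
Proof. by case: paraP => _ sP _ _; rewrite -size_poly_eq0 size_map_poly sP. Qed.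

Let root_unit (z : R[i]) : root PC z -> z * conjc z = 1.
Proof. by have := @paraorthogonal_zero_unit R n c s P n0 pos s2 paraP z. Qed.

Let root_conj (z : R[i]) : root PC z -> root PC (conjc z).
Proof.
rewrite -complex_root_conj; congr (root _ z).
apply/polyP => k; rewrite !coef_map /=.
by rewrite oppr0.
Qed.

Lemma conj_zeros (z : R[i]) : (conjc z \in zs) = (z \in zs).
Proof.
by rewrite !mem_zeros //; apply/idP/idP => /root_conj //; rewrite conjcK.
Qed.

Let U_unit (z : R[i]) : z \in U -> z * conjc z = 1.
Proof. by rewrite mem_filter mem_zeros // => /andP[_ /root_unit]. Qed.

Lemma perm_zero_angles : perm_eq ths [seq upper_arg z | z <- U].
Proof. by rewrite /ths /zero_angles perm_sort. Qed.

Lemma zero_angles_root t : t \in ths ->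
  exists z, [/\ root PC z, 0 < complex.Im z & upper_arg z = t].
Proof.
rewrite (perm_mem perm_zero_angles) => /mapP[z zU ->]; exists z.
by move: zU; rewrite mem_filter mem_zeros // => /andP[].
Qed.

Lemma zero_angles_in t : t \in ths -> 0 < t < pi.
Proof. by case/zero_angles_root => z [_ iz <-]; case: (upper_argP iz). Qed.

Lemma zero_angles_sorted : sorted <%R ths.
Proof.
rewrite lt_sorted_uniq_le sort_le_sorted andbT sort_uniq map_inj_in_uniq.
  by rewrite filter_uniq // (paraorthogonal_zeros_uniq n0 pos s2 paraP).
move=> z w zU wU /(congr1 cos); rewrite !cos_upper_arg ?U_unit // => Re_eq.
move: (unit_Re_Im (U_unit zU)); rewrite -(unit_Re_Im (U_unit wU)) Re_eq.
move/addrI/eqP; move: zU wU; rewrite !mem_filter => /andP[iz _] /andP[iw _].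
rewrite eqrXn2 ?ltW // => /eqP Im_eq.
by case: z w Re_eq Im_eq {iz iw} => [u v] [u' v'] /= -> ->.
Qed.

Lemma big_zero_angles (S : Type) (idx : S) (op : Monoid.com_law idx) (F : R -> S) :
  \big[op/idx]_(t <- ths) F (cos t) = \big[op/idx]_(z <- U) F (complex.Re z).
Proof.
rewrite (perm_big _ perm_zero_angles) /= big_map big_seq [RHS]big_seq.
by apply: eq_bigr => z zU; rewrite cos_upper_arg ?U_unit.
Qed.

Lemma real_root_pm1 (z : R[i]) : root PC z -> complex.Im z = 0 -> z = 1 \/ z = -1.
Proof.
move=> rz iz; have := unit_Re_Im (root_unit rz); rewrite iz expr0n addr0 => /eqP.
rewrite sqrf_eq1; case: z iz {rz} => u v /= -> /orP[] /eqP ->; [left|right] => //.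
by rewrite -[RHS]/(- 1 +i* - 0) oppr0.
Qed.

(** Nonreal zeros come in conjugate pairs, and a real zero is 1 or -1.  The
    two numerical equations determine e1 and e2: a conjugate pair contributes 2
    to the degree and a factor 1 to P(0) = s, whereas the zeros 1 and -1
    contribute -1 and 1 to P(0). *)
Lemma factor_paraorthogonal : exists e1 e2 : bool,
  [/\ P = ('X - 1%:P) ^+ e1 * ('X + 1%:P) ^+ e2 * \prod_(t <- ths) circle_pair (cos t),
      (n.+1 = e1 + e2 + (size ths).*2)%N,
      s = (-1) ^+ e1
    & forall z, root PC z ->
       [\/ exists2 t, t \in ths & complex.Re z = cos t,
           e1 /\ z = 1 | e2 /\ z = -1]].
Proof.
exists (1 \in zs), (-1 \in zs).
have uzs : uniq zs by exact: paraorthogonal_zeros_uniq n0 pos s2 paraP.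
pose V := [seq z <- zs | complex.Im z < 0].
pose W := [seq z <- zs | complex.Im z == 0].
have perm_zs : perm_eq zs (W ++ (U ++ V)).
  rewrite /U /V /W -(perm_filterC (fun z => complex.Im z == 0)) perm_cat2l.
  rewrite -(perm_filterC (fun z => 0 < complex.Im z)) -!filter_predI.
  apply: perm_cat; apply/permP => p; rewrite !count_filter; apply: eq_count => z /=.
    by case: ltgtP; rewrite ?andbT ?andbF.
  by case: ltgtP; rewrite ?andbT ?andbF.
have perm_V : perm_eq V (map conjc U).
  apply: uniq_perm; rewrite ?filter_uniq ?map_inj_uniq ?filter_uniq //.
    exact: (can_inj (@conjcK R)).
  move=> z; rewrite -[in RHS](conjcK z) mem_map; last exact: (can_inj (@conjcK R)).
  by rewrite !mem_filter conj_zeros; case: z => u v /=; rewrite oppr_gt0.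
have perm_W : perm_eq W [seq w <- [:: 1; -1] | w \in zs].
  apply: uniq_perm; rewrite ?filter_uniq //.
    by rewrite /= andbT in_cons in_nil orbF -subr_eq0 opprK -(natrD _ 1 1) pnatr_eq0.
  move=> z; rewrite !mem_filter andbC. apply: andb_id2l => zz.
  rewrite !inE; apply/eqP/idP => [|/orP[] /eqP-> //=]; last by rewrite oppr0.
  have rz : root PC z by rewrite -mem_zeros.
  by case/(real_root_pm1 rz) => ->; rewrite eqxx ?orbT.
have PE : P = ('X - 1%:P) ^+ (1 \in zs) * ('X + 1%:P) ^+ (-1 \in zs)
              * \prod_(t <- ths) circle_pair (cos t).
  apply: (map_poly_inj (real_complex R)).
  have PCE : PC = \prod_(z <- zs) ('X - z%:P) := zeros_prod paraP.
  apply: etrans PCE _; rewrite (perm_big _ perm_zs) !big_cat.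
  rewrite (perm_big _ perm_W) (perm_big _ perm_V).
  rewrite !rmorphM; congr (_ * _).
    rewrite big_filter !rmorphXn rmorphB rmorphD /= map_polyX !map_polyC /=.
    rewrite !big_cons big_nil.
    by case: (1 \in zs); case: (-1 \in zs);
      rewrite ?expr1 ?expr0 ?mulr1 ?mul1r // polyCN opprK.
  rewrite (big_zero_angles _ (@circle_pair R)) big_map /= -big_split rmorph_prod /=.
  rewrite big_seq [RHS]big_seq; apply: eq_bigr => z zU.
  by rewrite circle_pairE ?U_unit.
split => //.
- have [_ sP _ _] := paraP; have [mc sc] := monic_circle_pairs (map cos ths).
  move: sP; rewrite {1}PE -(big_map cos xpredT (@circle_pair R)) size_Mmonic //; last first.
    by rewrite mulf_neq0 // expf_neq0 // -?size_poly_eq0 ?size_XaddC ?size_XsubC.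
  rewrite sc size_map size_Mmonic ?monic_exp ?monicXaddC ?expf_neq0 //
    -?size_poly_eq0 ?size_XsubC //.
  by rewrite size_exp_XsubC size_exp_XaddC; lia.
- rewrite -(paraorthogonal_coef0 paraP) -horner_coef0 PE !hornerM !horner_exp horner_prod.
  rewrite big1 => [|t _].
    by rewrite hornerXsubC hornerD hornerX hornerC sub0r add0r expr1n !mulr1.
  by rewrite /circle_pair !hornerE expr0n subr0 add0r.
- move=> z rz; have zz : z \in zs by rewrite mem_zeros.
  have toU w : 0 < complex.Im w -> w \in zs -> exists2 t, t \in ths & complex.Re w = cos t.
    move=> iw wz; exists (upper_arg w).
      by rewrite (perm_mem perm_zero_angles) map_f // mem_filter iw.
    by rewrite cos_upper_arg // root_unit // -mem_zeros.
  case: (ltgtP (complex.Im z) 0) => iz.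
  + apply: Or31; have [||t tt Re_t] := toU (conjc z).
    * by case: z iz {rz zz} => u v /=; rewrite oppr_gt0.
    * by rewrite conj_zeros.
    * by exists t => //; rewrite -Re_t; case: z {rz zz iz Re_t}.
  + exact: Or31 (toU _ iz zz).
  + by case: (real_root_pm1 rz iz) => zE; [apply: Or32|apply: Or33]; rewrite -zE.
Qed.

End Factor.

(** * Symmetric M-matrices and polynomials with positive coefficients *)

Lemma sum_gt0 (R : numDomainType) (I : finType) (F : I -> R) (i : I) :
  (forall j, 0 <= F j) -> 0 < F i -> 0 < \sum_j F j.
Proof. by move=> F0 Fi; rewrite (bigD1 i) //= ltr_pwDl // sumr_ge0. Qed.

(** A positive definite matrix with nonpositive off-diagonal entries has a
    nonnegative inverse: test H r against the negative part u of r.  The cross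
    terms of u with the positive part p have disjoint supports, hence only see
    off-diagonal entries, and u^T H u = u^T H p - u^T (H r) is nonpositive. *)
Lemma m_matrix_pos (R : realDomainType) m (H : 'I_m -> 'I_m -> R) (r : 'I_m -> R) :
  (forall u : 'I_m -> R, (exists j, u j != 0) -> 0 < \sum_j \sum_k u j * u k * H j k) ->
  (forall j k, j != k -> H j k <= 0) ->
  (forall j, 0 < \sum_k H j k * r k) ->
  forall j, 0 < r j.
Proof.
move=> Hpos Hoff Hr.
pose u j := Num.max 0 (- r j); pose p j := Num.max 0 (r j).
have u0 j : 0 <= u j by rewrite le_max lexx.
have p0 j : 0 <= p j by rewrite le_max lexx.
have rE j : r j = p j - u j.
  by rewrite /u /p; case: (leP 0 (- r j)); case: (leP 0 (r j)); lra.
have pu j : u j * p j = 0.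
  rewrite /u /p; case: (leP 0 (- r j)) => h1; last by rewrite mul0r.
  by case: (leP 0 (r j)) => h2; rewrite ?mulr0 // (_ : r j = 0) ?mulr0 //; lra.
have uz j : u j = 0.
  apply/eqP; apply: contraT => uj; have := Hpos u (ex_intro _ j uj).
  rewrite ltNge => /negP[].
  rewrite (_ : \sum_j _ = \sum_j (\sum_k u j * p k * H j k)
                          - \sum_j u j * \sum_k H j k * r k); last first.
    rewrite -sumrB; apply: eq_bigr => i _; rewrite mulr_sumr -sumrB.
    by apply: eq_bigr => k _; rewrite rE; ring.
  rewrite subr_le0 (@le_trans _ _ 0) //.
    rewrite sumr_le0 // => i _; rewrite sumr_le0 // => k _.
    have [->|ik] := eqVneq i k; first by rewrite pu mul0r.
    by rewrite mulr_ge0_le0 ?mulr_ge0 // Hoff.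
  by rewrite sumr_ge0 // => i _; rewrite mulr_ge0 // ltW.
have r0 j : 0 <= r j by rewrite rE uz subr0.
(* If r_j = 0, only off-diagonal terms remain in the j-th entry of H r. *)
move=> j; rewrite lt_neqAle r0 andbT; apply/eqP => rj; have := Hr j.
rewrite ltNge => /negP[]; rewrite (bigD1 j) //= -rj mulr0 add0r.
by rewrite sumr_le0 // => k kj; rewrite mulr_le0_ge0 // Hoff // eq_sym.
Qed.

(** Positivity is asked of every coefficient up to the degree, not of the
    nonzero ones only: the strict inequalities need each moment to count. *)
Definition pos_coefs (R : numDomainType) (f : {poly R}) : Prop :=
  forall k, (k < size f)%N -> 0 < f`_k.

Section PosCoefs.
Variable R : numDomainType.
Implicit Types f g : {poly R}.

Lemma pos_coefs_ge0 f k : pos_coefs f -> 0 <= f`_k.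
Proof.
move=> pf; have [kf|kf] := ltnP k (size f); first exact/ltW/pf.
by rewrite nth_default.
Qed.

Lemma pos_coefs1 : pos_coefs (1 : {poly R}).
Proof. by move=> k; rewrite size_poly1 coef1; case: k. Qed.

Lemma pos_coefsM f g : pos_coefs f -> pos_coefs g -> pos_coefs (f * g).
Proof.
move=> pf pg k.
have [->|f0] := eqVneq f 0; first by rewrite mul0r size_poly0.
have [->|g0] := eqVneq g 0; first by rewrite mulr0 size_poly0.
rewrite size_mul // => kfg; rewrite coefM.
have sf : (0 < size f)%N by rewrite size_poly_gt0.
have sg : (0 < size g)%N by rewrite size_poly_gt0.
(* An index i with i <= deg f and k - i <= deg g. *)
have ik : (minn k (size f).-1 < k.+1)%N by rewrite ltnS geq_minl.
apply: (sum_gt0 (i := Ordinal ik)) => [j|/=].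
  by rewrite mulr_ge0 ?pos_coefs_ge0.
by rewrite mulr_gt0 // ?pf ?pg //; move: kfg sf sg; move: (size f) (size g) => p q; lia.
Qed.

Lemma pos_coefsX f k : pos_coefs f -> pos_coefs (f ^+ k).
Proof.
move=> pf; elim: k => [|k IH]; first by rewrite expr0; exact: pos_coefs1.
by rewrite exprS; exact: pos_coefsM.
Qed.

Lemma pos_coefs_prod (I : finType) (p : pred I) (F : I -> {poly R}) :
  (forall i, pos_coefs (F i)) -> pos_coefs (\prod_(i | p i) F i).
Proof.
by move=> pF; apply: big_ind => //; [exact: pos_coefs1|exact: pos_coefsM].
Qed.

Lemma pos_coefsXadd1 : pos_coefs ('X + 1%:P : {poly R}).
Proof.
move=> k; rewrite size_XaddC coefD coefX coefC.
by case: k => [|[|]] //=; rewrite ?add0r ?addr0.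
Qed.

End PosCoefs.

Lemma coef_circle_pair (R : realType) (x : R) k :
  (circle_pair x)`_k = [:: 1; - (2 * x); 1]`_k.
Proof.
rewrite /circle_pair !coefD coefN coefZ coefXn coefX coef1.
by case: k => [|[|[|k]]] /=; rewrite ?nth_nil; ring.
Qed.

Lemma pos_coefs_circle_pair (R : realType) (x : R) :
  x < 0 -> pos_coefs (circle_pair x).
Proof.
move=> x0 k; rewrite (monic_circle_pair x).2 coef_circle_pair.
by case: k => [|[|[|]]] //= _; lra.
Qed.

(** On the circle z^2 + 1 = 2 z Re z. *)
Lemma horner_circle_pair (R : realType) (x : R) (z : R[i]) : z * conjc z = 1 ->
  (map_poly (real_complex R) (circle_pair x)).[z] = z * 2 * (complex.Re z - x)%:C.
Proof.
move=> zz.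
rewrite /circle_pair rmorphD rmorphB /= map_polyXn rmorph1 -mul_polyC rmorphM /=.
rewrite map_polyC map_polyX /=.
rewrite !hornerE rmorphB mulrBr.
have -> : z * 2 * (complex.Re z)%:C = z * (z + conjc z) by rewrite addcJ mulrA.
by rewrite mulrDr zz rmorphM /= rmorph_nat -/(real_complex R); ring.
Qed.

Section MomentPos.
Variables (R : realType) (n : nat) (d : int -> R).
Hypothesis d0 : forall k : int, - n%:Z <= k <= n%:Z -> 0 <= d k.

Lemma moment_ge0 (f : {poly R}) :
  (forall k, 0 <= f`_k) -> (size f <= n.*2.+1)%N -> 0 <= moment d n f.
Proof.
move=> f0 sf; apply: sumr_ge0 => j _; rewrite mulr_ge0 // d0 //.
have := leq_trans (ltn_ord j) sf; move: (nat_of_ord j) => i; lia.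
Qed.

Lemma moment_gt0 f k : pos_coefs f -> size f = n.*2.+1 ->
  - n%:Z <= k <= n%:Z -> 0 < d k -> 0 < moment d n f.
Proof.
move=> pf sf kn dk.
have ik : (`|n%:Z - k| < size f)%N by rewrite sf; lia.
apply: (sum_gt0 (i := Ordinal ik)) => [j|/=].
  rewrite mulr_ge0 ?pos_coefs_ge0 // d0 //.
  by have := leq_trans (ltn_ord j) (eq_leq sf); move: (nat_of_ord j) => i; lia.
by rewrite mulr_gt0 ?pf // (_ : n%:Z - _ = k) //; lia.
Qed.

End MomentPos.

(** * Comparison of the zeros in the left half-plane *)

Lemma rev_conj_mul_circle_pair (R : realType) (z : R[i]) n (f : {poly R}) :
  z * conjc z = 1 -> (size f <= n.+1)%N ->
  rev_conj n.+2 (map_poly (real_complex R) (circle_pair (complex.Re z) * f)) =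
  map_poly (real_complex R) (circle_pair (complex.Re z))
  * rev_conj n (map_poly (real_complex R) f).
Proof.
move=> zz sf; rewrite rmorphM /= -circle_pairE // -mulrA.
have z0 : z != 0 by apply: contra_eq_neq zz => ->; rewrite mul0r eq_sym oner_neq0.
have sfC : (size (map_poly (real_complex R) f) <= n.+1)%N by rewrite size_map_poly.
rewrite !rev_conj_mulXsubC //; last first.
  by rewrite (leq_trans (size_polyMleq _ _)) // size_XsubC.
rewrite mulrA conjcK; congr (_ * _).
have e (w : R[i]) : w * conjc w = 1 -> 1 - conjc w *: 'X = - conjc w *: ('X - w%:P).
  move=> ww; rewrite scaleNr scalerBr opprB -[_ *: w%:P]mul_polyC.
  by rewrite -polyCM [_ * w]mulrC ww.
have zz' : conjc z * conjc (conjc z) = 1 by rewrite conjcK mulrC.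
have := e _ zz'; rewrite conjcK => ->.
by rewrite e // -scalerAl -scalerAr scalerA mulrNN [_ * z]mulrC zz scale1r mulrC.
Qed.

Lemma unit_of_Re (R : realType) (y : R) : -1 < y < 1 ->
  exists z : R[i], [/\ z * conjc z = 1, complex.Re z = y & 0 < complex.Im z].
Proof.
move=> /andP[y1 y2]; exists (y +i* Num.sqrt (1 - y ^+ 2)).
have h : 0 < 1 - y ^+ 2 by nra.
split => //=; last by rewrite sqrtr_gt0.
apply/eqP; rewrite eq_complex /=; apply/andP; split; apply/eqP; last by ring.
rewrite mulrN opprK -[X in _ + X]expr2 sqr_sqrtr ?ltW //; ring.
Qed.

Lemma horner_circle_product (R : realType) m (e : bool) (p : pred 'I_m) (y : 'I_m -> R)
    (z : R[i]) : z * conjc z = 1 ->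
  (map_poly (real_complex R) (('X + 1%:P) ^+ e * \prod_(k | p k) circle_pair (y k))).[z] =
  (z + 1) ^+ e * \prod_(k | p k) (z * 2) * (\prod_(k | p k) (complex.Re z - y k))%:C.
Proof.
move=> zz; rewrite rmorphM rmorphXn rmorphD /= map_polyX map_polyC rmorph_prod /=.
rewrite hornerM horner_exp hornerD hornerX hornerC horner_prod -mulrA; congr (_ * _).
rewrite rmorph_prod -big_split; apply: eq_bigr => k _ /=.
by rewrite horner_circle_pair.
Qed.

Section Comparison.
Variables (R : realType) (n m : nat) (e : bool) (a b : int -> R).
Variables (PA PB : {poly R}) (x y : 'I_m -> R).
Hypotheses (n0 : (0 < n)%N) (posa : posdef n a) (posb : posdef n b).
Hypotheses (paraA : paraorthogonal n a 1 PA) (paraB : paraorthogonal n b 1 PB).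
Hypothesis (PAE : PA = ('X + 1%:P) ^+ e * \prod_k circle_pair (x k)).
Hypothesis (PBE : PB = ('X + 1%:P) ^+ e * \prod_k circle_pair (y k)).
Hypothesis (y_inj : injective y).
Hypothesis (y_neg : forall k, -1 < y k < 0).
Hypothesis (d_ge0 : forall k : int, - n%:Z <= k <= n%:Z -> 0 <= b k - a k).
Hypothesis (d_gt0 : exists2 k : int, - n%:Z <= k <= n%:Z & 0 < b k - a k).

(* [q1 j] is the polynomial q_j obtained from P_B by removing the j-th pair of
   zeros; general index sets are needed to remove two pairs. *)
Let toC := map_poly (real_complex R).
Let d (k : int) := b k - a k.
Let q (p : pred 'I_m) : {poly R} :=
  ('X + 1%:P) ^+ e * \prod_(k | p k) circle_pair (y k).
Let q1 j := q (predC1 j).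
Let r j := 2 * (\prod_k (y j - x k)) / \prod_(k | k != j) (y j - y k).

Let moment_ab s f : moment a s f = moment b s f - moment d s f.
Proof. by rewrite /moment -sumrB; apply: eq_bigr => j _; rewrite /d; ring. Qed.

Let sizePB : size PB = n.+2. Proof. by case: paraB. Qed.

Let qD1 (p : pred 'I_m) j : p j -> q p = circle_pair (y j) * q (fun k => p k && (k != j)).
Proof. by move=> pj; rewrite /q (bigD1 j) //= mulrCA. Qed.

Let PBq j : PB = circle_pair (y j) * q1 j.
Proof. by rewrite PBE -(@qD1 xpredT j). Qed.

Let q_neq0 p : q p != 0.
Proof.
rewrite mulf_neq0 ?expf_neq0 // -?size_poly_eq0 ?size_XaddC //.
rewrite size_poly_eq0; apply/prodf_neq0 => k _.
by rewrite -size_poly_eq0 (monic_circle_pair _).2.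
Qed.

Let size_circleM k f : f != 0 -> size (circle_pair (y k) * f) = (size f).+2.
Proof. by move=> f0; rewrite size_mul // -?size_poly_eq0 (monic_circle_pair _).2. Qed.

Let size_q1 j : size (q1 j) = n.
Proof. by have := sizePB; rewrite (PBq j) size_circleM ?q_neq0 // => -[]. Qed.

Let pos_q p : pos_coefs (q p).
Proof.
apply: pos_coefsM; first exact/pos_coefsX/pos_coefsXadd1.
by apply: pos_coefs_prod => k; apply: pos_coefs_circle_pair; case/andP: (y_neg k).
Qed.

Let ypt j : exists z : R[i], [/\ z * conjc z = 1, complex.Re z = y j & 0 < complex.Im z].
Proof. by apply: unit_of_Re; have /andP[-> /lt_trans->] := y_neg j. Qed.

(* P_B and the removed factor are self-reciprocal, hence so is the quotient. *)
Let q1_rec j k : (k < n)%N -> (q1 j)`_(n.-1 - k) = (q1 j)`_k.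
Proof.
move=> kn; have [z [zz Re_z _]] := ypt j.
have sq : (size (q1 j) <= n.-1.+1)%N by rewrite size_q1 prednK.
have := rev_conj_mul_circle_pair zz sq; rewrite Re_z -PBq prednK //.
have -> : rev_conj n.+1 (toC PB) = toC PB.
  have [_ _ _ recB] := paraB.
  apply/polyP => i; rewrite coef_rev_conj !coef_map /= ltnS; case: leqP => i1.
    by rewrite recB // mul1r oppr0.
  by rewrite nth_default ?sizePB.
rewrite {1}(PBq j) => /(@etrans _ _ _ _ (esym (rmorphM _ (circle_pair (y j)) (q1 j)))).
have c0 : toC (circle_pair (y j)) != 0.
  by rewrite map_poly_eq0 -size_poly_eq0 (monic_circle_pair _).2.
move/(mulfI c0)/polyP/(_ k); rewrite coef_rev_conj prednK // kn !coef_map /=.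
by case.
Qed.

Let horner_q p (z : R[i]) : z * conjc z = 1 ->
  (toC (q p)).[z] = (z + 1) ^+ e * \prod_(k | p k) (z * 2)
                    * (\prod_(k | p k) (complex.Re z - y k))%:C.
Proof. exact: horner_circle_product. Qed.

Let W : {poly R} := \poly_(k < n) (PA - PB)`_k.+1.

(* The leading and the constant coefficients of P_A and P_B agree. *)
Let XW : 'X * W = PA - PB.
Proof.
have [mA sA _ _] := paraA; have [mB sB _ _] := paraB.
have cA : PA`_0 = PB`_0 by rewrite (paraorthogonal_coef0 paraA) (paraorthogonal_coef0 paraB).
apply/polyP => -[|k]; rewrite coefXM /= ?coefB ?cA ?subrr //.
rewrite /W coef_poly coefB; case: ltngtP => // [nk|->].
  by rewrite !nth_default ?subrr // ?sA ?sB.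
move/monicP: mA; move/monicP: mB; rewrite /lead_coef sA sB /= => -> ->.
by rewrite subrr.
Qed.

Let size_W : (size W <= n)%N. Proof. exact: size_poly. Qed.

Let hornerPA (z : R[i]) : z * conjc z = 1 ->
  (toC PA).[z] = (z + 1) ^+ e * \prod_(k < m) (z * 2)
                 * (\prod_k (complex.Re z - x k))%:C.
Proof. by move=> zz; rewrite PAE /toC horner_circle_product. Qed.

Let hornerXW (z : R[i]) : root (toC PB) z -> z * (toC W).[z] = (toC PA).[z].
Proof.
move=> /rootP rz; have := congr1 (fun f => (toC f).[z]) XW.
rewrite /toC rmorphM rmorphB /= map_polyX hornerM hornerD hornerN hornerX.
by rewrite [X in _ - X]rz subr0.
Qed.

Let prodB_neq0 j : \prod_(k | k != j) (y j - y k) != 0.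
Proof.
by apply/prodf_neq0 => k kj; rewrite subr_eq0 (inj_eq y_inj) eq_sym.
Qed.

Let q1_0 (z : R[i]) j k : z * conjc z = 1 -> complex.Re z = y j -> k != j ->
  (toC (q1 k)).[z] = 0.
Proof.
move=> zz Re_z kj; rewrite horner_q //.
rewrite (_ : \prod_(i | predC1 k i) (_ - y i) = 0) ?rmorph0 ?mulr0 //.
by rewrite (bigD1 j) /= 1?eq_sym // Re_z subrr mul0r.
Qed.

Let horner_comb (u : 'I_m -> R) (z : R[i]) :
  (toC (\sum_j u j *: q1 j)).[z] = \sum_j (u j)%:C * (toC (q1 j)).[z].
Proof.
rewrite /toC rmorph_sum horner_sum; apply: eq_bigr => j _ /=.
by rewrite -mul_polyC rmorphM /= map_polyC hornerM hornerC.
Qed.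

Let horner_comb_at (u : 'I_m -> R) (z : R[i]) j :
  z * conjc z = 1 -> complex.Re z = y j ->
  (toC (\sum_k u k *: q1 k)).[z] = (u j)%:C * (toC (q1 j)).[z].
Proof.
move=> zz Re_z; rewrite horner_comb (bigD1 j) //= big1 ?addr0 // => k kj.
by rewrite (q1_0 zz Re_z kj) mulr0.
Qed.

(* Lagrange interpolation: both sides have degree less than n and agree at the
   n + 1 zeros of P_B.  At -1 both vanish; at a zero with real part y_j
   only q_j survives, and the definition of r_j is the quotient of the two values. *)
Let W_expand : W = \sum_j r j *: q1 j.
Proof.
apply/eqP; rewrite -subr_eq0; set D := W - _.
have sD : (size D <= n)%N.
  rewrite (leq_trans (size_polyD _ _)) // geq_max size_W size_polyN.
  apply: (leq_trans (size_sum _ _ _)); apply/bigmax_leqP => j _.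
  by rewrite (leq_trans (size_scale_leq _ _)) ?size_q1.
rewrite -(map_poly_eq0 (real_complex R)) -/toC; apply/eqP.
apply: (@roots_geq_poly_eq0 _ _ (zeros (toC PB))); last first.
- have zprod : toC PB = \prod_(z <- zeros (toC PB)) ('X - z%:P) := zeros_prod paraB.
  have := congr1 (fun f : {poly R[i]} => size f) zprod.
  rewrite size_prod_XsubC size_map_poly sizePB => -[<-].
  by rewrite size_map_poly (leq_trans sD).
- by rewrite (paraorthogonal_zeros_uniq n0 posb _ paraB) ?expr1n.
have PB0 : toC PB != 0 by rewrite map_poly_eq0 -size_poly_eq0 sizePB.
apply/allP => z; rewrite mem_zeros // => rz.
have zz : z * conjc z = 1.
  by apply: (paraorthogonal_zero_unit n0 posb _ paraB); rewrite ?expr1n.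
have z0 : z != 0 by apply: contra_eq_neq zz => ->; rewrite mul0r eq_sym oner_neq0.
have DE : (toC D).[z] = (toC W).[z] - (toC (\sum_j r j *: q1 j)).[z].
  by rewrite /toC rmorphB /= hornerD hornerN.
apply/rootP; rewrite DE; apply: (mulfI z0); rewrite mulr0 mulrBr hornerXW // hornerPA //.
have [/andP[e1 /eqP z1]|nz1] := boolP (e && (z + 1 == 0)).
  rewrite z1 e1 expr1 !mul0r horner_comb big1 ?mulr0 ?subr0 // => j _.
  by rewrite horner_q // z1 e1 expr1 !mul0r mulr0.
have z1 : (z + 1) ^+ e != 0.
  by move: nz1; case: (e) => /= h; rewrite ?expr0 ?oner_neq0 // expr1.
have [j _ Re_z] : exists2 j, true & complex.Re z = y j.
  move/rootP: rz; rewrite PBE /toC horner_circle_product // => /eqP.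
  rewrite !mulf_eq0 (negPf z1) /= => /orP[/prodf_eq0[k _]|].
    by rewrite mulf_eq0 (negPf z0) pnatr_eq0.
  rewrite -[0]/(0%:C) (inj_eq (@complexI R)) => /prodf_eq0[k _].
  by rewrite subr_eq0 => /eqP; exists k.
rewrite (horner_comb_at r zz Re_z).
rewrite horner_q // (bigD1 j) //= Re_z.
set B := \prod_(k | k != j) (y j - _); set A := \prod_k (y j - _).
have rB : (r j)%:C * B%:C = 2 * A%:C.
  by rewrite -rmorphM /r -/A -/B mulfVK ?prodB_neq0 // rmorphM rmorph_nat.
set E := (z + 1) ^+ e; set Pz := \prod_(k < m | k != j) (z * 2).
rewrite (_ : _ - _ = E * z * Pz * (2 * A%:C - (r j)%:C * B%:C)); last by ring.
by rewrite rB subrr mulr0.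
Qed.

(* The factor 'X shifts the exponent: this is L_A[z^(1 - n) q_j q_k]. *)
Let H j k := moment a n ('X * (q1 j * q1 k)).

Let H_off j k : j != k -> H j k <= 0.
Proof.
move=> jk.
have qE : q1 k = circle_pair (y j) * q (fun i => (i != k) && (i != j)) by exact: qD1.
have szq : size (q (fun i => (i != k) && (i != j))) = n.-2.
  by have := size_q1 k; rewrite qE size_circleM ?q_neq0 // => <-.
have n2 : (1 < n)%N by have := size_q1 k; rewrite qE size_circleM ?q_neq0 // => <-.
rewrite /H moment_ab subr_le0.
(* q_j q_k is a multiple of P_B: q_k still contains the pair missing in q_j. *)
have -> : moment b n ('X * (q1 j * q1 k)) = 0.
  rewrite qE (_ : _ * _ = 'X * q (fun i => (i != k) && (i != j)) * PB); last first.
    by rewrite (PBq j); ring.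
  have [_ _ orthB _] := paraB; rewrite moment_orth //.
  by rewrite (leq_trans (size_polyMleq _ _)) // size_polyX szq; lia.
apply: (moment_ge0 d_ge0) => [i|].
  by rewrite coefXM; case: ifP => // _; apply/pos_coefs_ge0/pos_coefsM; exact: pos_q.
rewrite (leq_trans (size_polyMleq _ _)) // size_polyX.
by rewrite size_mul ?q_neq0 // !size_q1 -addnn /=; lia.
Qed.

(* Combinations V of the q_j are self-reciprocal, so H is the Gram matrix of the
   q_j for A; the q_j are independent since q_j alone is nonzero
   at the zeros with real part y_j. *)
Let H_pos u : (exists j, u j != 0) -> 0 < \sum_j \sum_k u j * u k * H j k.
Proof.
move=> [j uj]; pose V := \sum_j u j *: q1 j.
have sV : (size V <= n)%N.
  apply: (leq_trans (size_sum _ _ _)); apply/bigmax_leqP => i _.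
  by rewrite (leq_trans (size_scale_leq _ _)) ?size_q1.
have V0 : V != 0.
  have [z [zz Re_z iz]] := ypt j.
  apply/eqP => V0; have := horner_comb_at u zz Re_z.
  rewrite -/V V0 /toC rmorph0 horner0 => /esym/eqP.
  have z0 : z != 0 by apply: contra_eq_neq zz => ->; rewrite mul0r eq_sym oner_neq0.
  have z1 : z + 1 != 0.
    apply/eqP => /(congr1 (@complex.Re R)); rewrite raddfD /= Re_z => h.
    by have := y_neg j; lra.
  rewrite mulf_eq0 -[0]/(0%:C) (inj_eq (@complexI R)) (negPf uj) /= -/toC.
  rewrite horner_q // Re_z !mulf_eq0 (negPf (expf_neq0 _ z1)) /= => /orP[/prodf_eq0[k _]|].
    by rewrite mulf_eq0 (negPf z0) pnatr_eq0.
  by rewrite -[0]/(0%:C) (inj_eq (@complexI R)) (negPf (prodB_neq0 j)).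
have recV k : (k < n)%N -> V`_(n.-1 - k) = V`_k.
  by move=> kn; rewrite !coef_sum; apply: eq_bigr => i _; rewrite !coefZ q1_rec.
have -> : \sum_j \sum_k u j * u k * H j k = moment a n (V * ('X * V)).
  rewrite mulrCA {2}/V mulr_suml mulr_sumr moment_sum; apply: eq_bigr => i _.
  rewrite mulr_sumr mulr_sumr moment_sum; apply: eq_bigr => k _.
  rewrite /H -momentZ; congr moment.
  by rewrite -scalerAl -!scalerAr scalerA; congr (_ *: _); ring.
rewrite (@moment_form _ _ _ _ _ V).
- by apply: posa => //; rewrite (leq_trans sV).
- by rewrite (leq_trans sV).
- by rewrite (leq_trans (size_polyMleq _ _)) // size_polyX.
move=> k; rewrite leq_eqVlt => /orP[/eqP->|kn].
  by rewrite subnn coefXM eqxx nth_default.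
rewrite coefXM subn_eq0 leqNgt kn -(recV k) //=; congr (V`__); lia.
Qed.

(* By orthogonality for A and for B,
   0 = L_A[z^(- n) q_j P_A] = L_A[z^(1 - n) q_j W] - L_(B - A)[z^(- n) q_j P_B]. *)
Let H_r j : 0 < \sum_k H j k * r k.
Proof.
have -> : \sum_k H j k * r k = moment d n (q1 j * PB).
  transitivity (moment a n (q1 j * ('X * W))).
    rewrite W_expand !mulr_sumr moment_sum; apply: eq_bigr => k _.
    rewrite mulrC /H -momentZ; congr moment.
    by rewrite -!scalerAr; congr (_ *: _); ring.
  have [_ _ orthA _] := paraA; have [_ _ orthB _] := paraB.
  rewrite XW mulrBr -scaleN1r momentD momentZ moment_orth ?size_q1 // add0r.
  rewrite moment_ab moment_orth ?size_q1 //; ring.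
have [k kn dk] := d_gt0; apply: (moment_gt0 d_ge0 _ _ kn dk).
  by rewrite PBE; apply: pos_coefsM; exact: (pos_q).
by rewrite size_mul ?q_neq0 // ?size_q1 ?sizePB ?addnS -?addnn // -size_poly_eq0 sizePB.
Qed.

(** The entry r_j is positive, up to a square. *)
Lemma comparison_sign j : 0 < (\prod_k (y j - x k)) * \prod_(k | k != j) (y j - y k).
Proof.
have := m_matrix_pos H_pos H_off H_r j; rewrite /r.
set B := \prod_(k | k != j) _; set A := \prod_k _ => r0.
have B0 : B != 0 by exact: prodB_neq0.
have -> : A * B = (2 * A / B) * (B ^+ 2 / 2) by field.
by rewrite mulr_gt0 // divr_gt0 // lt_neqAle sqr_ge0 eq_sym sqrf_eq0 B0.
Qed.

End Comparison.

(** * From alternating signs to inequalities *)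

Lemma prod_signE (R : realDomainType) (I : finType) (p : pred I) (f : I -> R) :
  \prod_(i | p i) f i = (-1) ^+ (\sum_(i | p i) (f i < 0)%R) * \prod_(i | p i) `|f i|.
Proof.
rewrite -prodrXr -big_split; apply: eq_bigr => i _.
exact: realEsign (num_real _).
Qed.

(** Being monotone and changing parity at every step, N gains at least 1 each
    time; by parity the last value is at most m - 1, so there is no room for
    more. *)
Lemma staircase (m : nat) (N : nat -> nat) :
  (forall j, (j.+1 < m)%N -> (N j <= N j.+1)%N) ->
  (forall j, (j < m)%N -> odd (N j) = odd j) ->
  (forall j, (N j <= m)%N) ->
  forall j, (j < m)%N -> (N j <= j)%N.
Proof.
move=> mono par bnd.
have step i j : (j + i < m)%N -> (N j + i <= N (j + i))%N.
  elim: i => [|i IH] h; first by rewrite !addn0.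
  have h1 : (j + i < m)%N by lia.
  have := IH h1; have := mono (j + i)%N; have := par _ h1; have := par (j + i).+1.
  rewrite !addnS in h *; move=> p1 p0 /(_ h) mo ih.
  have {}p1 := p1 h; lia.
move=> j jm; have := step (m.-1 - j)%N j; rewrite subnKC; last lia.
have h : (m.-1 < m)%N by lia.
by have := par _ h; have := bnd m.-1; lia.
Qed.

Lemma sum_ltn_ord m j : (j <= m)%N -> (\sum_(k < m) (k < j) = j)%N.
Proof.
move=> jm; rewrite -[RHS]card_ord -sum1_card (big_ord_widen m (fun=> 1%N)) //.
by rewrite [RHS]big_mkcond; apply: eq_bigr => k _; case: ltnP.
Qed.

(** The count N j of the x_k above y_j has the parity of j, because exactly j
    of the y_k lie above y_j; hence N j <= j, whereas y_j < x_j would put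
    x_0, ..., x_j above y_j. *)
Lemma sign_alternation_lt (R : realDomainType) m (x y : nat -> R) :
  (forall i j, (i < j < m)%N -> x j < x i) ->
  (forall i j, (i < j < m)%N -> y j < y i) ->
  (forall j : 'I_m, 0 < (\prod_(k < m) (y j - x k)) * \prod_(k < m | k != j) (y j - y k)) ->
  forall j, (j < m)%N -> x j < y j.
Proof.
move=> xdec ydec alt.
pose N j := (\sum_(k < m) (y j < x k)%R)%N.
have Nle : forall j, (j < m)%N -> (N j <= j)%N.
  apply: staircase => [j jm|j jm|j].
  - apply: leq_sum => k _; case: (ltP (y j)) => // h.
    by rewrite (lt_trans (ydec _ _ _) h) // ltnSn.
  - have := alt (Ordinal jm); rewrite [X in X * _]prod_signE [X in _ * X]prod_signE /=.
    rewrite mulrACA -exprD.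
    rewrite (eq_bigr (fun k : 'I_m => nat_of_bool (y j < x k)%R)) => [|k _]; last first.
      by rewrite subr_lt0.
    have -> : (\sum_(k < m | k != Ordinal jm) (y j - y k < 0)%R = j)%N.
      rewrite big_mkcond -[RHS](@sum_ltn_ord m) ?(ltnW jm) //; apply: eq_bigr => k _.
      rewrite -val_eqE /= subr_lt0; case: ltngtP => kj //=.
        by rewrite ydec ?kj.
      by rewrite ltNge ltW // ydec // kj ltn_ord.
    rewrite -/(N j) -signr_odd oddD; case: (boolP (_ (+) _)) => h; last first.
      by move: h; case: odd; case: odd.
    by rewrite expr1 mulN1r oppr_gt0 ltNge mulr_ge0 // prodr_ge0.
  - rewrite (leq_trans (leq_sum _ (E2 := fun=> 1%N) _)) ?sum1_card ?card_ord // => k _.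
    by case: (_ < _).
move=> j jm; rewrite ltNge; apply/negP => yx.
have {}yx : y j < x j.
  rewrite lt_neqAle yx andbT; apply/eqP => e.
  by have := alt (Ordinal jm); rewrite (bigD1 (Ordinal jm)) //= e subrr !mul0r ltxx.
have := Nle j jm; rewrite leqNgt => /negP[].
rewrite -[X in (X <= _)%N](@sum_ltn_ord m) //; apply: leq_sum => k _.
case: ltnP => //= kj; rewrite (lt_le_trans yx) //.
move: kj; rewrite ltnS leq_eqVlt => /orP[/eqP->//|kj].
by rewrite ltW // xdec // kj.
Qed.

Lemma sorted_nth_dec (R : realDomainType) (s : seq R) i j :
  sorted >%R s -> (i < j < size s)%N -> s`_j < s`_i.
Proof.
move=> ss /andP[ij js]; have := sorted_ltn_nth (rev_trans lt_trans) 0 ss.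
by apply => //; rewrite inE // (ltn_trans ij).
Qed.

Lemma zero_cosines_lt (R : realType) n (e : bool) (a b : int -> R) (PA PB : {poly R})
    (xs ys : seq R) :
  (0 < n)%N -> posdef n a -> posdef n b ->
  paraorthogonal n a 1 PA -> paraorthogonal n b 1 PB ->
  PA = ('X + 1%:P) ^+ e * \prod_(x <- xs) circle_pair x ->
  PB = ('X + 1%:P) ^+ e * \prod_(y <- ys) circle_pair y ->
  size xs = size ys -> sorted >%R xs -> sorted >%R ys ->
  (forall y, y \in ys -> -1 < y < 0) ->
  (forall k : int, - n%:Z <= k <= n%:Z -> 0 <= b k - a k) ->
  (exists2 k : int, - n%:Z <= k <= n%:Z & 0 < b k - a k) ->
  forall j, (j < size ys)%N -> xs`_j < ys`_j.
Proof.
move=> n0 posa posb paraA paraB PAE PBE sxy sx sy yneg d0 d1.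
apply: sign_alternation_lt => [i j h|i j h|j].
- by apply: sorted_nth_dec; rewrite ?sxy.
- exact: sorted_nth_dec.
rewrite (big_nth 0) big_mkord in PBE; rewrite (big_nth 0) big_mkord sxy in PAE.
apply: (comparison_sign n0 posa posb paraA paraB PAE PBE) => // [i k|k].
  have h i' k' : (i' < k' < size ys)%N -> ys`_i' != ys`_k'.
    by move=> /(sorted_nth_dec sy) /gt_eqF ->.
  move=> /eqP e'; apply/val_inj; case: (ltngtP i k) => // ik; move: e'.
    by rewrite (negPf (h _ _ _)) // ik ltn_ord.
  by rewrite eq_sym (negPf (h _ _ _)) // ik ltn_ord.
by apply: yneg; rewrite mem_nth.
Qed.

(** * Passing from z to - z *)

Definition twist (R : realType) (c : int -> R) (k : int) : R := (-1) ^+ `|k|%N * c k.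

Lemma sign_dist (R : realType) (i j : nat) :
  (-1) ^+ `|i%:Z - j%:Z|%N = (-1) ^+ i * (-1) ^+ j :> R.
Proof.
rewrite -exprD -signr_odd -[RHS]signr_odd; congr (_ ^+ nat_of_bool _); lia.
Qed.

Lemma circle_pair_opp (R : realType) (x : R) : circle_pair x \Po - 'X = circle_pair (- x).
Proof.
rewrite /circle_pair comp_polyD comp_polyB comp_polyZ comp_polyX comp_Xn_poly rmorph1.
by rewrite sqrrN mulrN scalerN scaleNr.
Qed.

Section Twist.
Variables (R : realType) (n : nat) (c : int -> R).

Lemma posdef_twist : posdef n c -> posdef n (twist c).
Proof.
move=> pos f f0 fn.
pose g := \poly_(k < size f) ((-1) ^+ k * f`_k).
have coefg k : g`_k = (-1) ^+ k * f`_k.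
  by rewrite coef_poly; case: ltnP => // h; rewrite nth_default ?mulr0.
have g0 : g != 0.
  apply: contra_neq f0 => g0; apply/polyP => k; rewrite coef0.
  by apply/eqP; have /eqP := coefg k; rewrite g0 coef0 eq_sym mulf_eq0 signr_eq0.
have := pos g g0 (leq_trans (size_poly _ _) fn); congr (_ < _).
apply: eq_bigr => i _; apply: eq_bigr => j _.
by rewrite !coefg /twist sign_dist; ring.
Qed.

(** The factor (-1)^(n + 1) keeps the polynomial monic; for eps = (-1)^n it
    also turns the sign - eps of the self-reciprocity into 1. *)
Lemma paraorthogonal_twist s P : s = (-1) ^+ n.+1 -> paraorthogonal n c s P ->
  paraorthogonal n (twist c) 1 ((-1) ^+ n.+1 *: (P \Po - 'X)).
Proof.
move=> sE [mP sP orth recP].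
have coefP k : ((-1) ^+ n.+1 *: (P \Po - 'X))`_k = (-1) ^+ n.+1 * ((-1) ^+ k * P`_k).
  rewrite coefZ; congr (_ * _).
  have -> : P \Po - 'X = \poly_(i < size P) ((-1) ^+ i * P`_i).
    rewrite comp_polyE poly_def; apply: eq_bigr => i _.
    by rewrite -scaleN1r exprZn scalerA mulrC.
  by rewrite coef_poly; case: ltnP => // h; rewrite nth_default ?mulr0.
have sz : size ((-1) ^+ n.+1 *: (P \Po - 'X)) = n.+2.
  by rewrite size_scale ?signr_eq0 // size_comp_poly2 // size_polyN size_polyX.
have sqr k : (-1) ^+ k * (-1) ^+ k = 1 :> R by rewrite -expr2 sqrr_sign.
split => //.
- apply/monicP; rewrite /lead_coef sz coefP /= mulrA sqr mul1r.
  by move/monicP: mP; rewrite /lead_coef sP.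
- move=> k kn; rewrite -[RHS](mulr0 ((-1) ^+ n.+1 * (-1) ^+ k)) -[X in _ * X](orth k kn).
  rewrite /moment sz sP mulr_sumr; apply: eq_bigr => j _; rewrite coefP /twist sign_dist.
  by rewrite -[RHS]mulr1 -[X in _ = _ * X](sqr j); ring.
- move=> k kn; rewrite !coefP mul1r recP // sE.
  have -> : (-1) ^+ (n.+1 - k) = (-1) ^+ n.+1 * (-1) ^+ k :> R.
    by rewrite -exprD -signr_odd -[RHS]signr_odd oddB // oddD.
  by rewrite -[RHS]mulr1 -[X in _ = _ * X](sqr n.+1); ring.
Qed.
End Twist.

(** * Comparison of the angles *)

Lemma cos_lt (R : realType) (t u : R) : 0 < t < pi -> 0 < u < pi -> (cos t < cos u) = (u < t).
Proof.
move=> /andP[t0 t1] /andP[u0 u1].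
by rewrite ltr_cos // in_itv /= !ltW.
Qed.

Lemma cos_gtN1 (R : realType) (t : R) : 0 < t < pi -> -1 < cos t.
Proof.
move=> /andP[t0 t1]; rewrite -cospi ltr_cos // in_itv /= ?pi_ge0 ?lexx //.
by rewrite !ltW.
Qed.

Lemma cos_lt1 (R : realType) (t : R) : 0 < t < pi -> cos t < 1.
Proof.
move=> /andP[t0 t1]; rewrite -[ltRHS]cos0 ltr_cos // in_itv /= ?pi_ge0 ?lexx //.
by rewrite !ltW.
Qed.

Lemma sorted_cos (R : realType) (th : seq R) : (forall t, t \in th -> 0 < t < pi) ->
  sorted <%R th -> sorted >%R (map cos th).
Proof.
move=> in0pi; rewrite sorted_map; apply: (sub_in_sorted (P := [pred t | 0 < t < pi])).
  by move=> t u t0 u0 tu /=; rewrite cos_lt.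
by apply/allP => t /in0pi.
Qed.

Section Gap.
Variables (R : realType) (n : nat) (a b : int -> R).
Hypotheses (hA : sym_posdef (toeplitz n.+1 a)) (hB : sym_posdef (toeplitz n.+1 b)).

Lemma even_upto_abs (c : int -> R) (k : int) : even_upto n c -> - n%:Z <= k <= n%:Z ->
  c k = c `|k|%N%:Z.
Proof.
move=> ev kn; case: (leP 0 k) => k0; first by congr c; lia.
have := ev 0%N `|k|%N; rewrite sub0r subr0 => <-; [congr c; lia|lia|lia].
Qed.

Lemma toeplitz_neq : toeplitz n.+1 a <> toeplitz n.+1 b ->
  exists2 k : nat, (k <= n)%N & a k%:Z != b k%:Z.
Proof.
move=> neq; have [/existsP[k abk]|/existsPn eq] := boolP [exists k : 'I_n.+1, a k%:Z != b k%:Z].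
  by exists k => //; rewrite -ltnS.
case: neq; apply/matrixP => i j; rewrite !mxE.
have h : - n%:Z <= i%:Z - j%:Z <= n%:Z.
  by have := ltn_ord i; have := ltn_ord j; move: (nat_of_ord i) (nat_of_ord j); lia.
rewrite (even_upto_abs (sym_posdef_even hA) h) (even_upto_abs (sym_posdef_even hB) h).
have kn : (`|i%:Z - j%:Z| < n.+1)%N by lia.
by have := eq (Ordinal kn) => /negPn/eqP.
Qed.

Lemma paraorth_eq eps : toeplitz n.+1 a = toeplitz n.+1 b -> paraorth n a eps = paraorth n b eps.
Proof.
move=> /matrixP ab.
have abE (i j : nat) : (i <= n)%N -> (j <= n)%N -> a (i%:Z - j%:Z) = b (i%:Z - j%:Z).
  rewrite -![(_ <= n)%N]ltnS => hi hj.
  by have := ab (Ordinal hi) (Ordinal hj); rewrite !mxE.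
suff e : monic_op n a = monic_op n b by rewrite /paraorth e.
rewrite /monic_op; congr (_^-1 *: _); congr (\det _); apply/matrixP => i j; rewrite !mxE.
  by rewrite abE // ltnW.
by case: ifP => // h; rewrite abE // -ltnS.
Qed.
End Gap.

Lemma paraorth_factor (R : realType) n (c : int -> R) (eps : R) :
  (0 < n)%N -> sym_posdef (toeplitz n.+1 c) -> eps ^+ 2 = 1 ->
  let th := zero_angles (paraorth n c eps) in
  exists P e1 e2,
  [/\ paraorthogonal n c (- eps) P,
      P = ('X - 1%:P) ^+ nat_of_bool e1 * ('X + 1%:P) ^+ nat_of_bool e2
          * \prod_(t <- th) circle_pair (cos t),
      (n.+1 = e1 + e2 + (size th).*2)%N,
      - eps = (-1) ^+ e1
    & [/\ sorted <%R th,
          forall t, t \in th -> 0 < t < pi,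
          forall t, t \in th ->
            exists2 z, root (paraorth n c eps) z & complex.Re z = cos t
        & forall z, root (paraorth n c eps) z ->
            [\/ exists2 t, t \in th & complex.Re z = cos t,
                e1 /\ z = 1 | e2 /\ z = -1]]].
Proof.
move=> n0 hc eps2.
have pos := sym_posdef_posdef hc; have ev := sym_posdef_even hc.
have s2 : (- eps) ^+ 2 = 1 by rewrite sqrrN.
have [P paraP PE] := paraorth_real_form n0 pos ev eps2; rewrite PE.
have [e1 [e2 [PF szP signP zerosP]]] := factor_paraorthogonal n0 pos s2 paraP.
exists P, e1, e2; split=> //; split=> //.
- exact: zero_angles_sorted n0 pos s2 paraP.
- by move=> t; apply: (zero_angles_in paraP).
move=> t /(zero_angles_root paraP)[z [rz iz <-]].
exists z => //; rewrite cos_upper_arg //.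
exact: paraorthogonal_zero_unit n0 pos s2 paraP _ rz.
Qed.

Section StrictComparison.
Variables (R : realType) (n : nat) (a b : int -> R).
Hypothesis (n0 : (0 < n)%N).
Hypotheses (hA : sym_posdef (toeplitz n.+1 a)) (hB : sym_posdef (toeplitz n.+1 b)).
Hypothesis (ab : toeplitz n.+1 a <> toeplitz n.+1 b).

Let posa := sym_posdef_posdef hA.
Let posb := sym_posdef_posdef hB.
Let eva := sym_posdef_even hA.
Let evb := sym_posdef_even hB.

(** P(0) = 1 excludes the zero 1, and the parity of n + 1 decides for both
    polynomials alike whether -1 is a zero. *)
Lemma zero_angles_left :
  let PA := paraorth n a (-1) in let PB := paraorth n b (-1) in
  (forall z : R[i], root PB z -> complex.Re z < 0) ->
  (forall k : nat, (k <= n)%N -> 0 <= b k%:Z - a k%:Z) ->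
  (forall z : R[i], root PA z -> complex.Re z < 0) /\
  forall j, (j < n.+1./2)%N -> (zero_angles PB)`_j < (zero_angles PA)`_j.
Proof.
move=> PA PB neg gap.
have sN1 : (-1) ^+ 2 = 1 :> R by rewrite sqrrN expr1n.
have [A [a1 [a2 [+ AE szA sA [sortA inA rootA zerosA]]]]] := paraorth_factor n0 hA sN1.
have [B [b1 [b2 [+ BE szB sB [sortB inB rootB zerosB]]]]] := paraorth_factor n0 hB sN1.
rewrite -/PA -/PB in AE BE szA szB sortA sortB inA inB rootA rootB zerosA zerosB *.
rewrite opprK => paraB paraA.
have no1 (e : bool) : - -1 = (-1) ^+ e :> R -> e = false.
  by case: e => // /eqP; rewrite expr1 opprK -subr_eq0 opprK -(natrD _ 1 1) pnatr_eq0.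
rewrite (no1 _ sA) in AE szA zerosA; rewrite (no1 _ sB) in BE szB zerosB.
have e12 : a2 = b2 by case: a2 b2 szA szB {AE BE zerosA zerosB} => [] [] //; lia.
have szAB : size (zero_angles PA) = size (zero_angles PB) by rewrite e12 in szA; lia.
have lt_cos : forall j, (j < size (zero_angles PB))%N ->
    cos (zero_angles PA)`_j < cos (zero_angles PB)`_j.
  move=> j jB; have jA : (j < size (zero_angles PA))%N by rewrite szAB.
  rewrite -(nth_map 0 0) // -[ltRHS](nth_map 0 0) //.
  rewrite expr0 mul1r -(big_map cos xpredT (@circle_pair R)) in AE.
  rewrite expr0 mul1r -(big_map cos xpredT (@circle_pair R)) in BE.
  rewrite e12 in AE.
  apply: (zero_cosines_lt n0 posa posb paraA paraB AE BE); rewrite ?size_map ?szAB //.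
  - exact: sorted_cos.
  - exact: sorted_cos.
  - move=> _ /mapP[t tB ->]; rewrite cos_gtN1 ?inB //=.
    by have [z rz <-] := rootB _ tB; exact: neg.
  - move=> k kn; rewrite (even_upto_abs eva kn) (even_upto_abs evb kn) gap //; lia.
  - have [k kn abk] := toeplitz_neq hA hB ab; exists k%:Z; first by lia.
    by rewrite lt_neqAle gap // eq_sym subr_eq0 eq_sym abk.
split=> [z rz|j jn].
  case: (zerosA _ rz) => [[t tA ->]|[]//|[_ ->]]; last by rewrite /= oppr_lt0 ltr01.
  have jA : (index t (zero_angles PA) < size (zero_angles PA))%N by rewrite index_mem.
  have jB := jA; rewrite szAB in jB.
  have := lt_cos _ jB; rewrite nth_index // => /lt_trans; apply.
  by have [w rw <-] := rootB _ (mem_nth 0 jB); exact: neg.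
have jB : (j < size (zero_angles PB))%N by lia.
have jA : (j < size (zero_angles PA))%N by rewrite szAB.
by have := lt_cos j jB; rewrite cos_lt; [|apply/inA/mem_nth|apply/inB/mem_nth].
Qed.

(** Here P(0) = (-1)^(n + 1), so that 1 is a zero exactly when n is even and -1
    never is one.  Substituting - z turns the angles t into pi - t, whose
    cosines - cos t decrease when listed in reverse. *)
Lemma zero_angles_right :
  let PA := paraorth n a ((-1) ^+ n) in let PB := paraorth n b ((-1) ^+ n) in
  (forall z : R[i], root PB z -> 0 < complex.Re z) ->
  (forall k : nat, (k <= n)%N -> 0 <= (-1) ^+ k * (b k%:Z - a k%:Z)) ->
  (forall z : R[i], root PA z -> 0 < complex.Re z) /\
  forall j, (j < n.+1./2)%N -> (zero_angles PA)`_j < (zero_angles PB)`_j.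
Proof.
move=> PA PB pos gap.
have sn : ((-1) ^+ n) ^+ 2 = 1 :> R by rewrite sqrr_sign.
have [A [a1 [a2 [paraA AE szA sA [sortA inA rootA zerosA]]]]] := paraorth_factor n0 hA sn.
have [B [b1 [b2 [paraB BE szB sB [sortB inB rootB zerosB]]]]] := paraorth_factor n0 hB sn.
rewrite -/PA -/PB in AE BE szA szB sortA sortB inA inB rootA rootB zerosA zerosB *.
have sE : - (-1) ^+ n = (-1) ^+ n.+1 :> R by rewrite exprS mulN1r.
have e_odd (e : bool) : - (-1) ^+ n = (-1) ^+ e :> R -> e = odd n.+1.
  by rewrite sE => /eqP; rewrite -signr_odd (inj_eq (@signr_inj R)); case: odd e => [] [].
have a20 : a2 = false by move: szA; rewrite (e_odd _ sA); case: a2 {AE zerosA} => //; lia.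
have b20 : b2 = false by move: szB; rewrite (e_odd _ sB); case: b2 {BE zerosB} => //; lia.
rewrite {}a20 in AE szA zerosA; rewrite {}b20 in BE szB zerosB.
have szAB : size (zero_angles PA) = size (zero_angles PB).
  by rewrite (e_odd _ sA) in szA; rewrite (e_odd _ sB) in szB; lia.
pose L (P : {poly R[i]}) := rev (map (fun t => - cos t) (zero_angles P)).
have twistE (C : {poly R}) (e : bool) (P : {poly R[i]}) : - (-1) ^+ n = (-1) ^+ e :> R ->
    C = ('X - 1%:P) ^+ e * ('X + 1%:P) ^+ false
        * \prod_(t <- zero_angles P) circle_pair (cos t) ->
    (-1) ^+ n.+1 *: (C \Po - 'X) =
    ('X + 1%:P) ^+ odd n.+1 * \prod_(x <- L P) circle_pair x.
  move=> se ->; rewrite expr0 mulr1 (e_odd _ se) rmorphM rmorphXn /=.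
  rewrite rmorph_prod /= comp_polyB comp_polyX comp_polyC -opprD.
  rewrite (perm_big _ (permEl (perm_rev _))) big_map.
  under eq_bigr do rewrite circle_pair_opp.
  rewrite -[- (_ + _)]scaleN1r exprZn -scalerAl scalerA -signr_odd /= -expr2 sqrr_sign.
  by rewrite scale1r.
have lt_cos : forall j, (j < size (zero_angles PB))%N ->
    cos (zero_angles PB)`_j < cos (zero_angles PA)`_j.
  move=> j jB; have jA : (j < size (zero_angles PA))%N by rewrite szAB.
  have := zero_cosines_lt n0 (posdef_twist posa) (posdef_twist posb)
    (paraorthogonal_twist sE paraA) (paraorthogonal_twist sE paraB)
    (twistE _ _ _ sA AE) (twistE _ _ _ sB BE).
  have sorted_L (P : {poly R[i]}) : (forall t, t \in zero_angles P -> 0 < t < pi) ->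
      sorted <%R (zero_angles P) -> sorted >%R (L P).
    move=> inP sP; rewrite rev_sorted (map_comp -%R cos) sorted_map.
    rewrite (eq_sorted (e' := >%R)) ?sorted_cos // => u v /=.
    by rewrite ltrN2.
  rewrite !size_rev !size_map => /(_ szAB (sorted_L _ inA sortA) (sorted_L _ inB sortB)) h.
  suff : (L PA)`_((size (zero_angles PB)).-1 - j) < (L PB)`_((size (zero_angles PB)).-1 - j).
    rewrite !nth_rev ?size_map ?szAB; [|lia|lia].
    have -> : (size (zero_angles PB) - ((size (zero_angles PB)).-1 - j).+1)%N = j by lia.
    by rewrite !(nth_map 0) // ltrN2.
  apply: h => [y|k kn|| ]; last by lia.
  - rewrite mem_rev => /mapP[t tB ->]; rewrite ltrN2 cos_lt1 ?inB // oppr_lt0.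
    by have [z rz <-] := rootB _ tB; exact: pos.
  - rewrite /twist -mulrBr (even_upto_abs eva kn) (even_upto_abs evb kn) gap //; lia.
  have [k kn abk] := toeplitz_neq hA hB ab; exists k%:Z; first by lia.
  rewrite /twist absz_nat -mulrBr lt_neqAle gap // andbT eq_sym mulf_neq0 ?signr_eq0 //.
  by rewrite subr_eq0 eq_sym.
split=> [z rz|j jn].
  case: (zerosA _ rz) => [[t tA ->]|[_ ->]|[]//]; last by rewrite /= ltr01.
  have jA : (index t (zero_angles PA) < size (zero_angles PA))%N by rewrite index_mem.
  have jB := jA; rewrite szAB in jB.
  have := lt_cos _ jB; rewrite nth_index //; apply: lt_trans.
  by have [w rw <-] := rootB _ (mem_nth 0 jB); exact: pos.
have jB : (j < size (zero_angles PB))%N by lia.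
have jA : (j < size (zero_angles PA))%N by rewrite szAB.
by have := lt_cos j jB; rewrite cos_lt; [|apply/inB/mem_nth|apply/inA/mem_nth].
Qed.
End StrictComparison.

Theorem theorem2p9 (R : realType) (n : nat) (hn : (1 <= n)%N)
  (a b : int -> R)
  (hA : sym_posdef (toeplitz n.+1 a)) (hB : sym_posdef (toeplitz n.+1 b)) :
  (let PA := paraorth n a ((-1) ^+ n) in
   let PB := paraorth n b ((-1) ^+ n) in
   (forall z : R[i], root PB z -> 0 < complex.Re z) ->
   (forall k : nat, (k <= n)%N -> 0 <= (-1) ^+ k * (b k%:Z - a k%:Z)) ->
   [/\ forall z : R[i], root PA z -> 0 < complex.Re z,
       forall j : nat, (j < n.+1./2)%N ->
         (zero_angles PA)`_j <= (zero_angles PB)`_j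
     & toeplitz n.+1 a <> toeplitz n.+1 b ->
       forall j : nat, (j < n.+1./2)%N ->
         (zero_angles PA)`_j < (zero_angles PB)`_j])
  /\
  (let PA := paraorth n a (-1) in
   let PB := paraorth n b (-1) in
   (forall z : R[i], root PB z -> complex.Re z < 0) ->
   (forall k : nat, (k <= n)%N -> 0 <= b k%:Z - a k%:Z) ->
   [/\ forall z : R[i], root PA z -> complex.Re z < 0,
       forall j : nat, (j < n.+1./2)%N ->
         (zero_angles PB)`_j <= (zero_angles PA)`_j
     & toeplitz n.+1 a <> toeplitz n.+1 b ->
       forall j : nat, (j < n.+1./2)%N ->
         (zero_angles PB)`_j < (zero_angles PA)`_j]).
Proof.
split=> PA PB sgnB gap.
  have [ab|/eqP ab] := eqVneq (toeplitz n.+1 a) (toeplitz n.+1 b).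
    have PAB : PA = PB by exact: paraorth_eq.
    by rewrite PAB; split=> [//|//|/(_ ab)].
  have [sgnA lt_angles] := zero_angles_right hn hA hB ab sgnB gap.
  by split=> // j jn; rewrite ltW ?lt_angles.
have [ab|/eqP ab] := eqVneq (toeplitz n.+1 a) (toeplitz n.+1 b).
  have PAB : PA = PB by exact: paraorth_eq.
  by rewrite PAB; split=> [//|//|/(_ ab)].
have [sgnA lt_angles] := zero_angles_left hn hA hB ab sgnB gap.
by split=> // j jn; rewrite ltW ?lt_angles.
Qed.
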